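(* Let $X$ be a homogeneous vector field of degree $d$ on $\mathbb{P}^2_{\mathbb{C}}$ and let $n$ be a positive integer. If $X$ does not have a rational first integral of degree $\le n$, then $X$ has at most $$\frac{d(n^3+6n^2+11n+6)-n^3-2n^2+n+2}{8}$$ irreducible invariant algebraic curves of degree $n$.
   Context: A homogeneous vector field $X$ of degree $d$ on $\mathbb{P}^2_{\mathbb{C}}$ is represented by a vector field $X=A\frac{\partial}{\partial x}+B\frac{\partial}{\partial y}+C\frac{\partial}{\partial z}$ on $\mathbb{C}^3$ with $A,B,C$ homogeneous polynomials of degree $d$, inducing via the radial projection a field of directions on $\mathbb{P}^2_{\mathbb{C}}$ (so $X$ is not a multiple of the radial field $R=x\frac{\partial}{\partial x}+y\frac{\partial}{\partial y}+z\frac{\partial}{\partial z}$). An algebraic curve with equation $F=0$, $F$ a nonzero homogeneous polynomial, is invariant by $X$ if $X(F)=L_F F$ for some polynomial $L_F$. A rational first integral of degree $e$ is a non-constant rational function $P/Q$, with $P,Q$ coprime homogeneous polynomials in $x,y,z$ of degree $e$, such that $X(P/Q)=0$. *)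

(* Defs.v *)
From HB Require Import structures.
From mathcomp Require Import all_boot all_order all_algebra generic_quotient.
From mathcomp Require Import fraction reals complex mpoly ring.

Set Implicit Arguments.
Unset Strict Implicit.
Unset Printing Implicit Defensive.

Import GRing.Theory.
Local Open Scope ring_scope.
Local Open Scope quotient_scope.

(* The field of complex numbers is R[i] for R : realType, and the
   coordinates x, y, z are 'X_0, 'X_1, 'X_2. *)
Notation Cxyz R := {mpoly R[i][3]}.

(* X stands for X 0 * d/dx + X 1 * d/dy + X 2 * d/dz on C^3. *)
Definition vfield (R : realType) := 'I_3 -> Cxyz R.

Definition vf_app (R : realType) (X : vfield R) (F : Cxyz R) : Cxyz R :=
  \sum_(i < 3) X i * mderiv i F.

(* The action on rational functions is given by the quotient rule applied to
   some numerator and denominator; vf_fracE shows that it does not depend on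
   their choice. *)
Definition vf_frac (R : realType) (X : vfield R) (f : {fraction Cxyz R}) :
    {fraction Cxyz R} :=
  let P := \n_(repr f) in let Q := \d_(repr f) in
  tofrac (vf_app X P * Q - P * vf_app X Q) / tofrac (Q ^+ 2).

(* The second condition says that X is not a multiple of the radial field; it
   excludes in particular X = 0. Some X i may vanish: 0 is d.-homog. *)
Definition homogeneous_vfield (R : realType) (d : nat) (X : vfield R) : Prop :=
  (forall i, X i \is d.-homog) /\
  ~ (exists G : Cxyz R, forall i : 'I_3, X i = G * 'X_i).

Definition mpoly_irreducible (R : realType) (F : Cxyz R) : Prop :=
  [/\ F != 0, F \isn't a GRing.unit &
      forall G H : Cxyz R, F = G * H ->
        G \is a GRing.unit \/ H \is a GRing.unit].

Definition mpoly_coprime (R : realType) (P Q : Cxyz R) : Prop :=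
  forall D P' Q' : Cxyz R, P = D * P' -> Q = D * Q' -> D \is a GRing.unit.

Definition invariant_curve (R : realType) (X : vfield R) (F : Cxyz R) : Prop :=
  exists L : Cxyz R, vf_app X F = L * F.

Definition irreducible_invariant_curve (R : realType) (X : vfield R) (n : nat)
    (F : Cxyz R) : Prop :=
  [/\ F \is n.-homog, mpoly_irreducible F & invariant_curve X F].

(* A curve is an equation up to a nonzero scalar factor. *)
Definition same_curve (R : realType) (F G : Cxyz R) : Prop :=
  exists2 c : R[i], c != 0 & G = c *: F.

Definition rational_first_integral (R : realType) (X : vfield R) (e : nat)
    (P Q : Cxyz R) : Prop :=
  [/\ P \is e.-homog /\ Q \is e.-homog,
      Q != 0 /\ mpoly_coprime P Q,
      ~ (exists c : R[i], tofrac P / tofrac Q = tofrac c%:MP) &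
      vf_frac X (tofrac P / tofrac Q) = 0].

Definition has_rational_first_integral (R : realType) (X : vfield R)
    (e : nat) : Prop :=
  exists P Q : Cxyz R, rational_first_integral X e P Q.

Lemma vf_appM (R : realType) (X : vfield R) (F G : Cxyz R) :
  vf_app X (F * G) = vf_app X F * G + F * vf_app X G.
Proof.
rewrite /vf_app mulr_suml mulr_sumr -big_split; apply: eq_bigr => i _ /=.
by rewrite mderivM mulrDr [F * (_ * _)]mulrCA !mulrA.
Qed.

Lemma quotient_rule_aux (T : comNzRingType) (P Q N D p q n d : T) :
  P * D = N * Q -> p * D + P * d = n * Q + N * q ->
  (n * D - N * d) * Q ^+ 2 = (p * Q - P * q) * D ^+ 2.
Proof.
move=> e e'.
have -> : (n * D - N * d) * Q ^+ 2 =
    (n * Q + N * q) * (D * Q) - (N * Q) * (q * D + d * Q) by ring.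
by rewrite -e' -e; ring.
Qed.

Lemma tofrac_repr (T : idomainType) (f : {fraction T}) :
  f = tofrac \n_(repr f) / tofrac \d_(repr f).
Proof.
have d0 := denom_ratioP (repr f).
apply: (canRL (mulfK _)); first by rewrite tofrac_eq0.
rewrite -{1}[f]reprK; unlock tofrac.
rewrite -[LHS]pi_mul; apply/eqmodP.
by rewrite /= FracField.equivfE /FracField.mulf !numden_Ratio ?mulr1 ?oner_eq0 //
   mulrC.
Qed.

Lemma quotient_rule_repr (T : idomainType) (der : T -> T) (P Q : T) :
  (forall F G, der (F * G) = der F * G + F * der G) -> Q != 0 ->
  let f := tofrac P / tofrac Q in
  let N := \n_(repr f) in let D := \d_(repr f) in
  tofrac (der N * D - N * der D) / tofrac (D ^+ 2) =
  tofrac (der P * Q - P * der Q) / tofrac (Q ^+ 2).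
Proof.
move=> derM Q0 f; have d0 := denom_ratioP (repr f); have := tofrac_repr f.
rewrite /f; move: (\n_(repr _)) (\d_(repr _)) d0 => N D D0 /eqP.
rewrite eqr_div ?tofrac_eq0 // -!tofracM tofrac_eq => /eqP e.
apply/eqP; rewrite eqr_div ?tofrac_eq0 ?expf_neq0 // -!tofracM tofrac_eq.
have := congr1 der e; rewrite !derM => e'.
by apply/eqP; exact: quotient_rule_aux.
Qed.

Lemma vf_fracE (R : realType) (X : vfield R) (P Q : Cxyz R) : Q != 0 ->
  vf_frac X (tofrac P / tofrac Q) =
  tofrac (vf_app X P * Q - P * vf_app X Q) / tofrac (Q ^+ 2).
Proof. by move=> Q0; apply: quotient_rule_repr Q0; apply: vf_appM. Qed.

(* Main.v *)
Require Import Defs.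
From HB Require Import structures.
From mathcomp Require Import all_boot all_order all_algebra perm.
From mathcomp Require Import boolp reals complex mpoly ring zify.

Set Implicit Arguments.
Unset Strict Implicit.
Unset Printing Implicit Defensive.

Import Order.TTheory GRing.Theory Num.Theory.

Local Open Scope ring_scope.

(** Let v_1, ..., v_m be the monomials of degree n in the coordinates, and let
    the extactic matrix have the iterated derivatives X^j(v_1), ..., X^j(v_m) for
    its row of index j < m. If F is an invariant form of degree n, then F is a
    constant combination of the v_i and every X^j(F) is a multiple of F, so
    that, by Cramer's rule, F divides the determinant
    ([invariant_divides_extactic]). Irreducible forms are prime ([ufd_mpoly]);
    hence k distinct irreducible invariant curves force k * n to be at most the
    degree of the determinant, unless it vanishes. This degree is the sum of
    the n + j (d - 1) for j < m, which is n times the stated bound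
    ([sum_extactic_degree]).

    It remains to see that a vanishing determinant yields a rational first
    integral of degree at most n ([extactic_pencil]). A relation of minimal
    support between the columns has coefficients whose ratios are killed by X,
    and also by the Euler field, because each row is homogeneous
    ([wronskian_relation]). So there is a relation sum_i c_i v_i = 0 between
    the v_i over the field of homogeneous first integrals of degree 0. Write
    the c_i in variables y = (y_0, y_1, y_2) and the v_i in variables
    x = (x_0, x_1, x_2): the polynomial G(x, y) = sum_i c_i(y) v_i(x) has
    degree n in x, vanishes on the diagonal x = y, and is, up to a denominator in y, an eigenvector of X acting on y.

    Let f be a prime factor of G that vanishes on the diagonal. It is again an
    eigenvector of X and of the Euler field acting on y ([prime_eigen]). By the
    chain rule the derivative of f along X acting on x vanishes on the
    diagonal, and it has the same eigenvalues as f. If it were not a multiple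
    of f, a resultant would give a polynomial in two of the variables x that
    vanishes at x = y and is still an eigenvector. In the quotient by scalings
    this is an algebraic equation for y_0 / y_1 over the constants of X, so X
    kills y_0 / y_1 ([no_relation_in_two_variables]), which is a first integral
    of degree 1.

    Otherwise X acting on x maps f to L f. The cofactor L is free of y, because
    the Euler field acting on y kills it ([generic_curve]). Therefore the
    coefficients of f with respect to y, which are forms in x of the same
    degree at most n, are all invariant with the same cofactor L, and the
    quotient of two of them is a first integral. Two of them are not
    proportional, because f vanishes on the diagonal and a product p(y) q(x)
    does not ([generic_curve_pencil]). *)

(** * Unique factorisation domains *)

Section Divisibility.
Variable R : idomainType.
Implicit Types a b c p : R.

Definition divides a b := exists c, b = c * a.

Definition irreducible_elt p :=
  [/\ p != 0, p \isn't a GRing.unit &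
      forall a b, p = a * b -> a \is a GRing.unit \/ b \is a GRing.unit].

Definition prime_elt p :=
  [/\ p != 0, p \isn't a GRing.unit &
      forall a b, divides p (a * b) -> divides p a \/ divides p b].

(** The value of [nu] is a length: along a factorisation it never decreases, and
    it strictly increases with every nonunit factor. *)
Definition size_bound (nu : R -> nat) :=
  forall a b, a * b != 0 ->
    (nu a + (b \isn't a GRing.unit) <= nu (a * b)%R)%N.

(** This pair of conditions characterises unique factorisation domains.  It is
    the form that passes easily from a ring to its polynomials: lengths add up,
    and primes only have to be recognised, never enumerated. *)
Definition ufd :=
  (forall p, irreducible_elt p -> prime_elt p) /\ exists nu, size_bound nu.

Lemma dividesMl a b p : divides p b -> divides p (a * b).
Proof. by case=> c ->; exists (a * c); rewrite mulrA. Qed.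

Lemma dividesMr a b p : divides p a -> divides p (a * b).
Proof. by rewrite mulrC; exact: dividesMl. Qed.

Lemma dividesD a b p : divides p a -> divides p b -> divides p (a + b).
Proof. by case=> c -> [e ->]; exists (c + e); rewrite mulrDl. Qed.

Lemma divides_refl p : divides p p.
Proof. by exists 1; rewrite mul1r. Qed.

Lemma divides_unitr a u p : u \is a GRing.unit -> divides p (u * a) ->
  divides p a.
Proof. by move=> Uu [c e]; exists (u^-1 * c); rewrite -mulrA -e mulKr. Qed.

Lemma split_or_irreducible a : a != 0 -> a \isn't a GRing.unit ->
  irreducible_elt a \/ exists b c, [/\ a = b * c, b \isn't a GRing.unit &
    c \isn't a GRing.unit].
Proof.
move=> a0 Ua; have [h|h] := EM (irreducible_elt a); first by left.
right; apply: contrapT => h'; apply: h; split=> // b c e.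
have [Ub|Ub] := boolP (b \is a GRing.unit); first by left.
have [Uc|Uc] := boolP (c \is a GRing.unit); first by right.
by case: h'; exists b, c.
Qed.

(** Induction along a prime factorisation: splitting a nonunit into nonunits
    terminates because lengths decrease. *)
Lemma ufd_ind (P : R -> Prop) : ufd ->
  (forall u, u \is a GRing.unit -> P u) -> (forall p, prime_elt p -> P p) ->
  (forall a b, a * b != 0 -> P a -> P b -> P (a * b)) ->
  forall a, a != 0 -> P a.
Proof.
move=> U Pu Pp Pm; have [irr [nu nuP]] := U.
move=> a; have [k] := ubnP (nu a); elim: k a => // k IH a le_k a0.
have [Ua|Ua] := boolP (a \is a GRing.unit); first exact: Pu.
case: (split_or_irreducible a0 Ua) => [/irr|]; first exact: Pp.
case=> b [c [e Ub Uc]]; move: a0 le_k; rewrite e => bc0 le_k.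
have := bc0; rewrite mulf_eq0 => /norP[b0 c0].
have := nuP _ _ bc0; rewrite Uc addn1 => lt_b.
have := nuP c b; rewrite mulrC => /(_ bc0); rewrite Ub addn1 => lt_c.
rewrite ltnS in le_k.
apply: Pm => //; apply: IH => //; first exact: leq_trans lt_b le_k.
exact: leq_trans lt_c le_k.
Qed.

(** The kernel of a morphism to a domain is a prime ideal, so one of the prime
    factors of [a] lies in it. *)
Lemma ufd_prime_in_kernel (S : idomainType) (f : {rmorphism R -> S}) a : ufd ->
  a != 0 -> f a = 0 -> exists p, [/\ prime_elt p, divides p a & f p = 0].
Proof.
move=> U; apply: (ufd_ind (P := fun a => f a = 0 ->
  exists p, [/\ prime_elt p, divides p a & f p = 0])) => // {a}.
- by move=> u Uu fu; have := rmorph_unit f Uu; rewrite fu unitr0.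
- by move=> p pp fp; exists p; split=> //; exact: divides_refl.
move=> a b ab0 IHa IHb; rewrite rmorphM => /eqP; rewrite mulf_eq0.
case/orP => /eqP; [move/IHa|move/IHb] => -[p [pp pa fp]]; exists p; split=> //.
  exact: dividesMr.
exact: dividesMl.
Qed.

Lemma ufd_max_power p a : ufd -> p \isn't a GRing.unit -> a != 0 ->
  exists k b, a = p ^+ k * b /\ ~ divides p b.
Proof.
move=> [_ [nu nuP]] Up; have [n] := ubnP (nu a); elim: n a => // n IH a le_n a0.
have [[b e]|nd] := EM (divides p a); last by exists 0%N, a; rewrite mul1r.
have b0 : b != 0 by apply: contraNneq a0 => b0; rewrite e b0 mul0r.
rewrite e in a0 le_n *; rewrite ltnS in le_n.
have := nuP _ _ a0; rewrite Up addn1 => lt_b.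
have [k [c [-> nc]]] := IH b (leq_trans lt_b le_n) b0.
by exists k.+1, c; rewrite exprSr mulrAC.
Qed.

End Divisibility.

Lemma ufd_field (F : fieldType) : ufd F.
Proof.
split=> [p [p0]|]; first by rewrite unitfE p0.
exists (fun=> 0%N) => a b; rewrite mulf_eq0 unitfE => /norP[_ ->].
by [].
Qed.

Section Isomorphism.
Variables (R S : idomainType) (f : {rmorphism R -> S}) (g : {rmorphism S -> R}).
Hypotheses (fK : cancel f g) (gK : cancel g f).

Lemma iso_unit a : (f a \is a GRing.unit) = (a \is a GRing.unit).
Proof.
by apply/idP/idP => [/(rmorph_unit g)|/(rmorph_unit f)]; rewrite ?fK.
Qed.

Lemma iso_eq0 a : (f a == 0) = (a == 0).
Proof. by rewrite -(inj_eq (can_inj fK)) rmorph0. Qed.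

Lemma iso_divides a b : divides (f a) (f b) <-> divides a b.
Proof.
split=> [[c e]|[c ->]]; last by exists (f c); rewrite rmorphM.
by exists (g c); apply: (can_inj fK); rewrite rmorphM gK.
Qed.

Lemma iso_prime a : prime_elt (f a) <-> prime_elt a.
Proof.
rewrite /prime_elt iso_eq0 iso_unit; split=> -[a0 Ua pa]; split=> // b c.
  by rewrite -!iso_divides rmorphM; exact: pa.
by rewrite -[b]gK -[c]gK -rmorphM !iso_divides; exact: pa.
Qed.

Lemma ufd_iso : ufd S -> ufd R.
Proof.
move=> [irr [nu nuP]]; split=> [p [p0 Up ip]|]; last first.
  exists (nu \o f) => a b ab0 /=; rewrite rmorphM -iso_unit; apply: nuP.
  by rewrite -rmorphM iso_eq0.
apply/iso_prime/irr; split; rewrite ?iso_eq0 ?iso_unit // => a b e.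
have /ip : p = g a * g b by rewrite -rmorphM -e fK.
by rewrite -!iso_unit !gK.
Qed.

End Isomorphism.

(** * Polynomials over a unique factorisation domain *)

Section PolyDivisibility.
Variable R : idomainType.
Implicit Types (c : R) (f g p q : {poly R}).
Import Pdiv.Idomain.

Lemma dividesCP c f : divides c%:P f <-> forall i, divides c f`_i.
Proof.
split=> [[g ->] i|/choice[d dP]]; first by exists g`_i; rewrite coefMC.
exists (\poly_(i < size f) d i); apply/polyP => i; rewrite coefMC coef_poly.
by case: ltnP => [_|le_i]; [exact: dP | rewrite mul0r nth_default].
Qed.

(** Gauss's lemma, in the form: a prime constant stays prime. *)
Lemma prime_polyC c : prime_elt c -> prime_elt c%:P.
Proof.
move=> [c0 Uc pc]; split; rewrite ?polyC_eq0 ?poly_unitE ?coefC ?size_polyC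
  ?c0 //.
have dX f : divides c%:P (f * 'X) -> divides c%:P f.
  by move/dividesCP => h; apply/dividesCP => i; have := h i.+1; rewrite coefMX.
have dXD f a : divides c%:P f -> divides c a -> divides c%:P (f * 'X + a%:P).
  move=> df [e ->]; apply: dividesD; first exact: dividesMr.
  by rewrite rmorphM; apply/dividesMl/divides_refl.
(* The lowest coefficients of the factors multiply to the lowest coefficient
   of the product, so one of them can be removed. *)
move=> f; elim/poly_ind: f => [|f a IHf] g.
  by move=> _; left; exists 0; rewrite mul0r.
elim/poly_ind: g => [|g b IHg]; first by move=> _; right; exists 0; rewrite mul0r.
move=> dfg; have /dividesCP/(_ 0%N) := dfg.
rewrite coef0M !coefD !coefMX !coefC !add0r /= => /pc[da|db].
  have [|df|dg] := IHf (g * 'X + b%:P); [|by left; exact: dXD|by right].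
  apply: dX; have -> : f * (g * 'X + b%:P) * 'X =
    (f * 'X + a%:P) * (g * 'X + b%:P) + (- (g * 'X + b%:P)) * a%:P by ring.
  apply: dividesD => //; apply: dividesMl.
  by case: da => e ->; rewrite rmorphM; apply/dividesMl/divides_refl.
have [|df|dg] := IHg; [|by left|by right; exact: dXD].
apply: dX; have -> : (f * 'X + a%:P) * g * 'X =
  (f * 'X + a%:P) * (g * 'X + b%:P) + (- (f * 'X + a%:P)) * b%:P by ring.
apply: dividesD => //; apply: dividesMl.
by case: db => e ->; rewrite rmorphM; apply/dividesMl/divides_refl.
Qed.

(** Pseudo-divisibility only sees the fraction field of [R]; the constants that
    it introduces are removed one prime of [R] at a time. *)
Lemma cancel_const c f q : ufd R ->
  (forall p : R, prime_elt p -> ~ divides p%:P f) ->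
  c != 0 -> divides f (c%:P * q) -> divides f q.
Proof.
move=> U prim c0; move: c c0 q.
apply: (ufd_ind U) => [u Uu q|p pp q [h e]|a b _ IHa IHb q].
- by apply: divides_unitr; rewrite rmorph_unit.
- have [p0 _ _] := pp; have [_ _ pr] := prime_polyC pp.
  have : divides p%:P (h * f) by rewrite -e; apply/dividesMr/divides_refl.
  case/pr => [[k ek]|/(prim _ pp)//].
  exists k; apply: (mulfI (_ : p%:P != 0)); first by rewrite polyC_eq0.
  by rewrite e ek; ring.
by rewrite rmorphM -mulrA => /IHa/IHb.
Qed.

(** The counterpart of [cancel_const] for factorisations: each prime of [c]
    divides one of the factors, and its removal does not change degrees. *)
Lemma factor_over_base c f g h : ufd R -> c != 0 -> c *: f = g * h ->
  exists g' h', [/\ f = g' * h', size g' = size g & size h' = size h].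
Proof.
move=> U c0; move: c c0 f g h.
apply: (ufd_ind U) => [u Uu f g h e|p pp f g h e|a b _ IHa IHb f g h].
- exists (u^-1 *: g), h; rewrite -scalerAl -e scalerA mulVr // scale1r.
  by rewrite size_scale // invr_eq0; apply: contraTneq Uu => ->; rewrite unitr0.
- have [p0 _ _] := pp; have [_ _ pr] := prime_polyC pp.
  have : divides p%:P (g * h).
    by rewrite -e -mul_polyC; apply/dividesMr/divides_refl.
  have pI : p%:P != 0 by rewrite polyC_eq0.
  have szp k : size (k * p%:P) = size k.
    by rewrite mulrC mul_polyC size_scale.
  case/pr=> -[k ek]; rewrite ek szp in e *.
    exists k, h; split=> //; apply: (mulfI pI); rewrite mul_polyC e; ring.
  exists g, k; split=> //; apply: (mulfI pI); rewrite mul_polyC e; ring.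
rewrite -scalerA => /IHa[g1 [h1 [/IHb[g2 [h2 [-> <- <-]]] <- <-]]].
by exists g2, h2.
Qed.

(** If [f] has no proper factor over the fraction field, a nontrivial common
    divisor of [f] and [q] has to be [f] itself. *)
Lemma size_gcd_dvd f q : (1 < size f)%N ->
  (forall g h c, c != 0 -> c *: f = g * h ->
    (size g <= 1)%N \/ (size h <= 1)%N) ->
  (1 < size (gcdp f q))%N -> exists2 c, c != 0 & divides f (c *: q).
Proof.
move=> f1 irr g1; set g := gcdp f q in g1.
have /dvdpP[[c h] /= c0 e] : g %| f by exact: dvdp_gcdl.
have /dvdpP[[d k] /= d0 e'] : g %| q by exact: dvdp_gcdr.
rewrite mulrC in e; case: (irr _ _ _ c0 e) => [|h1]; first by rewrite leqNgt g1.
rewrite (size1_polyC h1) in e.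
exists (h`_0 * d); last first.
  have -> : (h`_0 * d) *: q = k * (g * (h`_0)%:P).
    by rewrite -scalerA e' -mul_polyC; ring.
  by exists (c%:P * k); rewrite -e -mul_polyC; ring.
rewrite mulf_neq0 //; apply: contra_neq c0 => h0; apply/eqP.
move/eqP: e; rewrite h0 polyC0 mulr0 -mul_polyC mulf_eq0 polyC_eq0.
case/orP => [//|/eqP f0].
by rewrite f0 size_poly0 in f1.
Qed.

Lemma prime_divides_gcd f q : prime_elt f -> (1 < size f)%N ->
  (1 < size (gcdp f q))%N -> divides f q.
Proof.
move=> [f0 Uf pf] f1 g1.
have irr g h c : c != 0 -> c *: f = g * h -> (size g <= 1)%N \/ (size h <= 1)%N.
  move=> c0 e.
  have gh0 : g * h != 0 by rewrite -e -mul_polyC mulf_neq0 ?polyC_eq0.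
  have := gh0; rewrite mulf_eq0 => /norP[g0 h0].
  have szgh : (size g + size h).-1 = size f by rewrite -size_mul // -e size_scale.
  have large k : k != 0 -> divides f k -> (size f <= size k)%N.
    move=> k0 [r er]; have r0 : r != 0.
      by apply: contraNneq k0 => r0; rewrite er r0 mul0r.
    by rewrite er size_mul // (polySpred r0) addSn leq_addl.
  have /pf[/(large _ g0)|/(large _ h0)] : divides f (g * h).
  - by rewrite -e -mul_polyC; apply/dividesMl/divides_refl.
  - by right; lia.
  - by left; lia.
have [c c0] := size_gcd_dvd f1 irr g1; rewrite -mul_polyC => /pf[[k e]|//].
have cP0 : c%:P != 0 by rewrite polyC_eq0.
have k0 : k != 0 by apply: contraNneq cP0 => k0; rewrite e k0 mul0r.
have : size c%:P = (size k + size f).-1 by rewrite e size_mul.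
rewrite size_polyC c0 (polySpred k0) addSn => /= szf.
by move: f1; rewrite [X in (X < _)%N]szf ltnNge leq_addl.
Qed.

Lemma resultant_ideal p q : (1 < size p)%N -> (1 < size q)%N ->
  exists u v, (resultant p q)%:P = u * p + v * q.
Proof.
by move=> p1 q1; have [[u v] _ e] := resultant_in_ideal p1 q1; exists u, v.
Qed.

Lemma resultant_bezout p q : (1 < size p)%N -> q != 0 ->
  (size (gcdp p q) <= 1)%N ->
  exists c u v, c != 0 /\ c%:P = u * p + v * q.
Proof.
move=> p1 q0; rewrite leqNgt -resultant_eq0 => r0.
have [q1|/size1_polyC q1] := ltnP 1 (size q); last first.
  exists q`_0, 0, 1; rewrite -q1 mul0r mul1r add0r; split=> //.
  by apply: contraNneq q0 => q00; rewrite q1 q00.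
have [u [v e]] := resultant_ideal p1 q1.
by exists (resultant p q), u, v.
Qed.

Lemma irreducible_const c : irreducible_elt c%:P -> irreducible_elt c.
Proof.
case; rewrite polyC_eq0 poly_unitE coefC => c0; rewrite size_polyC c0 => Uc irr.
split=> // a b e; have [||] := irr a%:P b%:P; first by rewrite e rmorphM.
  by rewrite poly_unitE coefC => /andP[_]; left.
by rewrite poly_unitE coefC => /andP[_]; right.
Qed.

(** Over the fraction field, either [f] divides [a] or a Bezout relation shows
    that [f] divides [b]; [cancel_const] brings both conclusions back to [R]. *)
Lemma irreducible_poly_prime f : ufd R -> irreducible_elt f -> prime_elt f.
Proof.
move=> U irr; have [f0 Uf irrf] := irr.
have [f1|/size1_polyC fC] := ltnP 1 (size f); last first.
  rewrite fC in irr *; apply: prime_polyC; have [ip _] := U.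
  by apply/ip/irreducible_const.
have U1 (g : {poly R}) : g \is a GRing.unit -> (size g <= 1)%N.
  by rewrite poly_unitE => /andP[/eqP->].
have prim (p : R) : prime_elt p -> ~ divides p%:P f.
  case=> p0 Up _ [g e]; case: (irrf _ _ e) => [/U1/size1_polyC g1|].
    by move: f1; rewrite e g1 -rmorphM size_polyC; case: (_ != 0).
  by rewrite poly_unitE coefC (negPf Up) andbF.
have irrg g h c : c != 0 -> c *: f = g * h -> (size g <= 1)%N \/ (size h <= 1)%N.
  move=> c0 /(factor_over_base U c0)[g' [h' [/irrf e <- <-]]].
  by case: e => /U1; [left|right].
split=> // a b dab.
have [a0|a0] := eqVneq a 0; first by left; exists 0; rewrite a0 mul0r.
have [g1|g1] := ltnP 1 (size (gcdp f a)).
  have [c c0] := size_gcd_dvd f1 irrg g1; rewrite -mul_polyC => dca.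
  by left; exact: cancel_const dca.
have [c [u [v [c0 e]]]] := resultant_bezout f1 a0 g1.
right; apply: (cancel_const U prim c0); rewrite e.
have -> : (u * f + v * a) * b = u * b * f + v * (a * b) by ring.
by apply: dividesD; [apply/dividesMl/divides_refl | apply/dividesMl].
Qed.

(** The length of a polynomial is its size plus the length of its leading
    coefficient: a constant nonunit factor is seen by the latter. *)
Lemma ufd_poly : ufd R -> ufd {poly R}.
Proof.
move=> U; split=> [f|]; first exact: irreducible_poly_prime.
have [_ [nu nuP]] := U; exists (fun f => size f + nu (lead_coef f))%N => f g fg0.
have := fg0; rewrite mulf_eq0 => /norP[f0 g0].
have l0 : lead_coef f * lead_coef g != 0 by rewrite mulf_neq0 ?lead_coef_eq0.
have := nuP _ _ l0; rewrite lead_coefM size_mul // poly_unitE.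
have := size_poly_gt0 g; rewrite g0.
move: (nu _) (nu _) => x y.
have [g1|/eqP g1] := eqVneq (size g) 1%N.
  by rewrite lead_coefE g1 /= => _ le_xy; rewrite addn1 -addnA leq_add2l.
move=> g_gt0 /(leq_trans (leq_addr _ _)) le_xy /=.  
by case: (size g) g1 g_gt0 => [|[|b]] // _ _; lia.
Qed.

End PolyDivisibility.

(** * Multivariate polynomials: factorisation and homogeneous factors *)

Lemma raddf_mpoly_ext n (R : nzRingType) (V : zmodType)
    (f g : {additive {mpoly R[n]} -> V}) :
  (forall c m, f (c *: 'X_[m]) = g (c *: 'X_[m])) -> f =1 g.
Proof.
move=> fg p; rewrite [p]mpolyE !raddf_sum; apply: eq_bigr => m _; exact: fg.
Qed.

Section LastVariable.
Variables (n : nat) (R : idomainType).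
Implicit Types (p q : {mpoly R[n.+1]}) (f g : {poly {mpoly R[n]}}).

(** The inverse of [muni]: the last variable is put back in place of ['X]. *)
Definition of_uni f : {mpoly R[n.+1]} :=
  (map_poly (@mwiden n R) f).['X_ord_max].

HB.instance Definition _ := GRing.RMorphism.copy of_uni
  (horner_eval 'X_ord_max \o map_poly (@mwiden n R)).

Lemma of_uniC (r : {mpoly R[n]}) : of_uni r%:P = mwiden r.
Proof. by rewrite /of_uni map_polyC hornerC. Qed.

Lemma of_uniX : of_uni 'X = 'X_ord_max.
Proof. by rewrite /of_uni map_polyX hornerX. Qed.

Lemma of_uniD f g : of_uni (f + g) = of_uni f + of_uni g.
Proof. exact: rmorphD. Qed.

Lemma of_uniM f g : of_uni (f * g) = of_uni f * of_uni g.
Proof. exact: rmorphM. Qed.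

Lemma of_uniXn k : of_uni 'X^k = 'X_ord_max ^+ k.
Proof.
by elim: k => [|k IH]; rewrite ?rmorph1 // !exprS of_uniM of_uniX IH.
Qed.

Lemma of_uniZ (r : {mpoly R[n]}) f : of_uni (r *: f) = mwiden r * of_uni f.
Proof. by rewrite -mul_polyC of_uniM of_uniC. Qed.

Let low (m : 'X_{1..n.+1}) : 'X_{1..n} :=
  [multinom (m (widen_ord (leqnSn n) i)) | i < n].

Lemma muniZX (c : R) (m : 'X_{1..n.+1}) :
  muni (c *: 'X_[m]) = c *: 'X_[low m] *: 'X^(m ord_max).
Proof.
have [->|c0] := eqVneq c 0; first by rewrite !scale0r muni0.
rewrite muniE (perm_big _ (msuppZ _ c0)) msuppX big_seq1 /=.
by rewrite mcoeffZ mcoeffX eqxx mulr1.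
Qed.

Lemma muniK : cancel (@muni n R) of_uni.
Proof.
apply: (raddf_mpoly_ext (f := of_uni \o @muni n R) (g := idfun)) => c m /=.
rewrite muniZX of_uniZ mwidenZ mwidenX -scalerAl.
rewrite of_uniXn mpolyXn; congr (_ *: _).
rewrite -mpolyXD; congr 'X_[_]; apply/mnmP => i.
rewrite mnmDE mulmnE mnm1E.
case: (unliftP ord_max i) => [j ->|->]; last first.
  by rewrite mnmwiden_ordmax eqxx mul1n add0n.
have -> : lift ord_max j = widen_ord (leqnSn n) j.
  by apply: val_inj => /=; rewrite /bump leqNgt ltn_ord.
rewrite mnmwiden_widen mnmE -val_eqE /= gtn_eqF ?ltn_ord //.
by rewrite mul0n addn0.
Qed.

Lemma muni_mwiden (r : {mpoly R[n]}) : muni (mwiden r) = r%:P.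
Proof.
apply: (raddf_mpoly_ext (f := @muni n R \o @mwiden n R) (g := polyC)) => c m /=.
rewrite mwidenZ mwidenX muniZX mnmwiden_ordmax.
rewrite expr0 alg_polyC; congr (_ *: _)%:P; congr 'X_[_]; apply/mnmP => i.
by rewrite mnmE mnmwiden_widen.
Qed.

Lemma muniX : muni 'X_ord_max = 'X :> {poly {mpoly R[n]}}.
Proof.
rewrite -['X_ord_max]scale1r muniZX scale1r mnm1E eqxx expr1.
rewrite (_ : low _ = 0%MM) ?mpolyX0 ?scale1r //.
apply/mnmP => i; rewrite mnmE mnm1E mnm0E -val_eqE /=.
by rewrite gtn_eqF ?ltn_ord.
Qed.

Lemma of_uniK : cancel of_uni (@muni n R).
Proof.
elim/poly_ind => [|f a IH]; first by rewrite rmorph0 muni0.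
by rewrite of_uniD of_uniM muniD muniM IH of_uniX of_uniC muniX muni_mwiden.
Qed.

Lemma of_uni_combination c f g p q : c%:P = f * muni p + g * muni q ->
  mwiden c = of_uni f * p + of_uni g * q.
Proof.
by rewrite -of_uniC => ->; rewrite of_uniD; congr (_ + _); rewrite of_uniM muniK.
Qed.

Lemma muni_divides p q : divides (muni p) (muni q) <-> divides p q.
Proof. exact: (iso_divides muniK of_uniK). Qed.

Lemma muni_prime p : prime_elt (muni p) <-> prime_elt p.
Proof. exact: (iso_prime muniK of_uniK). Qed.

End LastVariable.

Lemma ufd_mpoly (R : idomainType) n : ufd R -> ufd {mpoly R[n]}.
Proof.
move=> U; elim: n => [|n IH]; last first.
  exact: (@ufd_iso _ _ (@muni n R) (@of_uni n R) (@muniK n R) (@of_uniK n R)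
    (ufd_poly IH)).
exact: (ufd_iso (f := mcoeff 0%MM) (@mpolyKC R) (@mpolyCK 0 R) U).
Qed.

Lemma dhomog0_const (R : nzRingType) n (F : {mpoly R[n]}) :
  F \is 0.-homog -> F = (F@_0)%:MP.
Proof.
move=> hF; apply/mpolyP => m; rewrite mcoeffC.
have [->|m0] := eqVneq m 0%MM; first by rewrite mulr1.
by rewrite mulr0; apply: (dhomog_nemf_coeff hF); rewrite mdeg_eq0.
Qed.

Lemma monomial_neq0 (R : nzRingType) n (m : 'X_{1..n}) :
  'X_[m] != 0 :> {mpoly R[n]}.
Proof. by rewrite -msupp_eq0 msuppX. Qed.

Section HomogeneousFactors.
Variables (n : nat) (R : idomainType).
Implicit Types p q : {mpoly R[n]}.

(** The product of the two lowest terms cannot cancel: the order on monomials is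
    compatible with multiplication. *)
Lemma mlastM p q : p != 0 -> q != 0 -> mlast (p * q) = (mlast p + mlast q)%MM.
Proof.
move=> p0 q0.
apply: mlastE => [|m /msuppM_le/allpairsP[[m1 m2] /= [m1p m2q ->]]]; last first.
  by apply: lem_add; apply: mlast_lemc.
rewrite mcoeff_msupp mpolyME (bigD1_seq (mlast p, mlast q)) /=; first last.
- by rewrite allpairs_uniq => // -[? ?] [].
- by rewrite allpairs_f // !mlast_supp.
rewrite mcoeffD mcoeffZ mcoeffX eqxx mulr1.
rewrite big_seq_cond raddf_sum /= big1 ?addr0.
  by rewrite mulf_neq0 // -mcoeff_msupp mlast_supp.
case=> m1 m2; rewrite ssrcomplements.in_allpairs //= -andbA.
case/and3P => m1p m2q ne.
rewrite mcoeffZ mcoeffX [_ == _](_ : _ = false) ?mulr0 //; apply/negbTE.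
apply: contraNneq ne => e.
have l1 := mlast_lemc m1p; have l2 := mlast_lemc m2q.
move: l1; rewrite le_eqVlt => /orP[/eqP e1|lt1]; last first.
  by have := ltmc_le_add lt1 l2; rewrite e ltxx.
by move: e; rewrite -e1 xpair_eqE eqxx => /eqP; rewrite eqm_add2l.
Qed.

(** Monomials are ordered by degree first, so that the extreme monomials of a
    product bound the degrees occurring in each factor. *)
Lemma dhomog_factor d p q : p * q != 0 -> p * q \is d.-homog ->
  exists k l, [/\ p \is k.-homog, q \is l.-homog & (k + l)%N = d].
Proof.
move=> pq0 /dhomogP hom; have := pq0; rewrite mulf_eq0 => /norP[p0 q0].
have hi : mdeg (mlead (p * q)) = d := hom _ (mlead_supp pq0).
have lo : mdeg (mlast (p * q)) = d := hom _ (mlast_supp pq0).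
rewrite mleadM // mdegD in hi; rewrite mlastM // mdegD in lo.
have bounds (r : {mpoly R[n]}) m : m \in msupp r ->
    (mdeg (mlast r) <= mdeg m <= mdeg (mlead r))%N.
  move=> mr; apply/andP; split; apply: lemc_mdeg; first exact: mlast_lemc.
  exact: msupp_le_mlead.
have /andP[_ lep] := bounds _ _ (mlast_supp p0).
have /andP[_ leq] := bounds _ _ (mlast_supp q0).
exists (mdeg (mlead p)), (mdeg (mlead q)); split=> //; apply/dhomogP => m.
  by move/bounds => b; rewrite -[LHS]/(mdeg m); lia.
by move/bounds => b; rewrite -[LHS]/(mdeg m); lia.
Qed.

End HomogeneousFactors.

(** * Derivations acting on coefficients and on variables *)

Lemma mderivXU n (R : nzRingType) (i j : 'I_n) :
  mderiv i ('X_j : {mpoly R[n]}) = (j == i)%:R.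
Proof.
rewrite mderivX mnm1E; case: eqP => [->|_]; last by rewrite scale0r.
have -> : (U_(i) - U_(i))%MM = 0%MM :> 'X_{1..n}.
  by rewrite -{1}[U_(i)%MM]add0m addmK.
by rewrite scale1r mpolyX0.
Qed.

Definition derivation (A : nzRingType) (D : A -> A) :=
  forall a b, D (a * b) = D a * b + a * D b.

Section CoefficientDerivation.
Variables (A : comNzRingType) (D : {additive A -> A}).
Hypothesis DM : derivation D.
Variable n : nat.
Implicit Types p q : {mpoly A[n]}.

Lemma derivation1 : D 1 = 0.
Proof.
have := DM 1 1; rewrite !mulr1 mul1r => /eqP.
by rewrite -subr_eq0 opprD addNKr oppr_eq0 => /eqP.
Qed.

Lemma derivation_nat k : D k%:R = 0.
Proof. by rewrite raddfMn derivation1 mul0rn. Qed.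

Lemma derivationX a k : D (a ^+ k.+1) = a ^+ k * D a *+ k.+1.
Proof.
elim: k => [|k IH]; first by rewrite expr0 mul1r.
by rewrite exprS DM IH mulrnAr mulrA -exprS [D a * _]mulrC -mulrS.
Qed.

Lemma map_derivationM p q :
  map_mpoly D (p * q) = map_mpoly D p * q + p * map_mpoly D q.
Proof.
apply/mpolyP => m; rewrite mcoeff_map_mpoly mcoeffD !mcoeffM raddf_sum -big_split.
by apply: eq_bigr => k _; rewrite DM !mcoeff_map_mpoly.
Qed.

Lemma map_derivationZ a p :
  map_mpoly D (a *: p) = D a *: p + a *: map_mpoly D p.
Proof. by rewrite -!mul_mpolyC map_derivationM map_mpolyC. Qed.

Lemma map_derivationXm m : map_mpoly D ('X_[m] : {mpoly A[n]}) = 0.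
Proof.
by apply/mpolyP => k; rewrite mcoeff_map_mpoly mcoeffX derivation_nat mcoeff0.
Qed.

Lemma map_derivationZX a (m : 'X_{1..n}) :
  map_mpoly D (a *: 'X_[m]) = D a *: 'X_[m].
Proof. by rewrite map_derivationZ map_derivationXm scaler0 addr0. Qed.

Lemma map_derivation_mderiv i p :
  map_mpoly D (mderiv i p) = mderiv i (map_mpoly D p).
Proof.
apply/mpolyP => m; rewrite mcoeff_map_mpoly !mcoeff_mderiv raddfMn.
by rewrite mcoeff_map_mpoly.
Qed.

Section ChainRule.
Variable v : 'I_n -> A.

Let chain p :=
  D p.@[v] = (map_mpoly D p).@[v] + \sum_i D (v i) * (mderiv i p).@[v].

Let chainM p q : chain p -> chain q -> chain (p * q).
Proof.
move=> cp cq; rewrite /chain mevalM DM cp cq map_derivationM mevalD !mevalM.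
rewrite [X in _ = _ + X](_ : _ =
    (\sum_i D (v i) * (mderiv i p).@[v]) * q.@[v] +
    p.@[v] * \sum_i D (v i) * (mderiv i q).@[v]); first by ring.
rewrite mulr_suml mulr_sumr -big_split; apply: eq_bigr => i _ /=.
by rewrite mderivM mevalD !mevalM; ring.
Qed.

Let chainC a : chain a%:MP.
Proof.
rewrite /chain map_mpolyC !mevalC big1 ?addr0 // => i _.
by rewrite mderivC meval0 mulr0.
Qed.

(** The point [v] need not be constant for [D], which explains the second sum. *)
Lemma derivation_chain p : chain p.
Proof.
elim/mpolyind: p => [|a m p _ _ cp]; first exact: (chainC 0).
have cX : chain 'X_[m].
  rewrite mpolyXE_id; apply: (big_ind chain) => [||i _]; first exact: (chainC 1).
    exact: chainM.
  elim: (m i) => [|k ck]; first exact: (chainC 1).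
  rewrite exprS; apply: chainM ck; rewrite /chain map_derivationXm meval0 add0r.
  rewrite mevalXU (bigD1 i) //= mderivXU eqxx meval1.
  rewrite mulr1 big1 ?addr0 // => j ji.
  by rewrite mderivXU eq_sym (negPf ji) meval0 mulr0.
have := chainM (chainC a) cX; rewrite mul_mpolyC /chain => caX.
rewrite mevalD raddfD caX cp raddfD mevalD.
rewrite [X in _ = _ + X](_ : _ = \sum_i D (v i) * (mderiv i (a *: 'X_[m])).@[v] +
  \sum_i D (v i) * (mderiv i p).@[v]); first by rewrite addrACA.
rewrite -big_split; apply: eq_bigr => i _ /=.
by rewrite mderivD mevalD mulrDr.
Qed.

End ChainRule.

End CoefficientDerivation.

Section LastVariableDerivation.
Variables (A : idomainType) (D : {additive A -> A}).
Hypothesis DM : derivation D.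
Variable n : nat.

Lemma map_derivation_mwiden (r : {mpoly A[n]}) :
  map_mpoly D (mwiden r) = mwiden (map_mpoly D r).
Proof.
apply: (raddf_mpoly_ext (f := map_mpoly D \o @mwiden n _)
  (g := @mwiden n _ \o map_mpoly D)) => c m /=.
by rewrite mwidenZ mwidenX !map_derivationZX // mwidenZ mwidenX.
Qed.

Lemma muni_map_derivation (p : {mpoly A[n.+1]}) :
  muni (map_mpoly D p) = map_poly (map_mpoly D) (muni p).
Proof.
apply: (raddf_mpoly_ext (f := @muni n _ \o map_mpoly D)
  (g := map_poly (map_mpoly D) \o @muni n _)) => c m /=.
rewrite map_derivationZX // !muniZX.
apply/polyP => k; rewrite coef_map /= !coefZ coefXn.
by case: eqP => _; rewrite ?mulr0 ?raddf0 // !mulr1 map_derivationZX.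
Qed.

End LastVariableDerivation.

Section VectorFields.
Variables (K : idomainType) (n : nat).
Local Notation A := {mpoly K[n]}.
Local Notation B := {mpoly {mpoly K[n]}[n]}.
Implicit Types (V : 'I_n -> A) (F G : A) (p : B).

(** The same sum as [vf_app], over any domain and in any number of variables. *)
Definition vder V F := \sum_(i < n) V i * mderiv i F.

Lemma vder_is_linear V : linear (vder V).
Proof.
move=> c F G; rewrite /vder scaler_sumr -big_split; apply: eq_bigr => i _.
by rewrite mderivD mderivZ mulrDr scalerAr.
Qed.

HB.instance Definition _ V :=
  GRing.isLinear.Build K A A _ (vder V) (vder_is_linear V).

Lemma vderM V F G : vder V (F * G) = vder V F * G + F * vder V G.
Proof.
rewrite /vder mulr_suml mulr_sumr -big_split; apply: eq_bigr => i _.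
by rewrite mderivM mulrDr [F * (_ * _)]mulrCA !mulrA.
Qed.

Lemma vderC V (c : K) : vder V c%:MP = 0.
Proof. by rewrite /vder big1 // => i _; rewrite mderivC mulr0. Qed.

Lemma vderX V i : vder V 'X_i = V i.
Proof.
rewrite /vder (bigD1 i) //= mderivXU eqxx mulr1 big1 ?addr0 // => j ji.
by rewrite mderivXU eq_sym (negPf ji) mulr0.
Qed.

(** An element of [B] is a polynomial in x with coefficients in the variables y.
    A polynomial in y is turned here into the same polynomial in x. *)
Definition lift_const : A -> B := map_mpoly (@mpolyC n K).

Lemma mcoeff_lift F m : (lift_const F)@_m = (F@_m)%:MP.
Proof. exact: mcoeff_map_mpoly. Qed.

Lemma map_vder_lift V F : map_mpoly (vder V) (lift_const F) = 0.
Proof.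
apply/mpolyP => m; rewrite [LHS]mcoeff_map_mpoly -[LHS]/(vder V _).
by rewrite mcoeff_lift vderC mcoeff0.
Qed.

Lemma lift_const_diag F : (lift_const F).@[fun i => 'X_i] = F.
Proof.
apply: (raddf_mpoly_ext (f := meval (fun i => 'X_i) \o map_mpoly (@mpolyC n K))
  (g := idfun)) => c m /=.
have -> : map_mpoly (@mpolyC n K) (c *: 'X_[m]) = c%:MP *: 'X_[m].
  apply/mpolyP => k; rewrite [LHS]mcoeff_map_mpoly /= [RHS]mcoeffZ !mcoeffX.
  by rewrite mcoeffZ mcoeffX mpolyCM rmorph_nat.
by rewrite mevalZ mevalX -mpolyXE_id mul_mpolyC.
Qed.

(** The coefficient of the monomial [mu] in y, as a polynomial in x. *)
Definition slice mu p : A := map_mpoly (mcoeff mu) p.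

Lemma mcoeff_slice mu p m : (slice mu p)@_m = p@_m@_mu.
Proof. exact: mcoeff_map_mpoly. Qed.

Lemma slice_liftM mu F p : slice mu (lift_const F * p) = F * slice mu p.
Proof.
apply/mpolyP => m; rewrite mcoeff_slice !mcoeffM raddf_sum.
by apply: eq_bigr => k _; rewrite /= mcoeff_lift mcoeffCM mcoeff_slice.
Qed.

Lemma slice_mderiv mu i p : slice mu (mderiv i p) = mderiv i (slice mu p).
Proof.
apply/mpolyP => m; rewrite mcoeff_slice !mcoeff_mderiv mcoeff_slice.
by rewrite raddfMn.
Qed.

(** A vector field acting on x only commutes with taking coefficients in y. *)
Lemma slice_vder mu V p :
  slice mu (\sum_i lift_const (V i) * mderiv i p) = vder V (slice mu p).
Proof.
rewrite /slice raddf_sum; apply: eq_bigr => i _.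
by rewrite -[LHS]/(slice mu _) slice_liftM slice_mderiv.
Qed.

End VectorFields.

(** * Prime factors of eigenvectors and elimination *)

(** Every prime factor of an eigenvector of a derivation is one, up to a
    denominator [a].  If [G = p ^+ k.+1 * u] with [u] prime to [p], then [D G] is
    [k.+1 * p ^+ k * D p * u] modulo [p ^+ k.+1], while [a * D G] is divisible by
    [p ^+ k.+1]. *)
Lemma derivation_prime_factor (B : idomainType) (D : {additive B -> B})
    (p G a b : B) :
  derivation D -> ufd B -> prime_elt p ->
  (forall k, ~ divides p k.+1%:R) -> ~ divides p a -> G != 0 -> divides p G ->
  a * D G = b * G -> divides p (D p).
Proof.
move=> DM U pp pk pa G0 pG e; have [p0 Up pr] := pp.
have [[|k] [u [eG pu]]] := ufd_max_power U Up G0.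
  by case: pu; move: pG; rewrite eG mul1r.
have pk0 : p ^+ k != 0 by rewrite expf_neq0.
have : divides p (a * k.+1%:R * D p * u).
  exists (b * u - a * D u); apply: (mulfI pk0).
  have : a * ((p ^+ k * D p *+ k.+1) * u + p ^+ k.+1 * D u) =
    b * (p ^+ k.+1 * u) by rewrite -derivationX // -DM -eG.
  rewrite -mulr_natr exprS => e'.
  have -> : p ^+ k * ((b * u - a * D u) * p) =
    b * (p * p ^+ k * u) - a * (p * p ^+ k * D u) by ring.
  by rewrite -e'; ring.
by move=> /pr[/pr[/pr[|/pk]|]|].
Qed.

(** Each term of the determinant is a product of [s] eigenvectors. *)
Lemma det_eigen (S : comNzRingType) (D : {additive S -> S}) (l : S) s
    (M : 'M[S]_s) :
  derivation D ->
  (forall i j, D (M i j) = l * M i j) -> D (\det M) = s%:R * l * \det M.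
Proof.
move=> DM DMl; rewrite /determinant raddf_sum mulr_sumr; apply: eq_bigr => t _.
have sgn (c : bool) : D ((-1) ^+ c) = 0.
  have D1 : D (-1) = 0 by rewrite raddfN (derivation1 DM) oppr0.
  by case: c; rewrite ?expr0 ?expr1 ?D1 ?(derivation1 DM).
rewrite DM sgn mul0r add0r mulrCA; congr (_ * _).
have eig (r : seq 'I_s) : D (\prod_(i <- r) M i (t i)) =
    (size r)%:R * l * \prod_(i <- r) M i (t i).
  elim: r => [|i r IH]; first by rewrite !big_nil (derivation1 DM) !mul0r.
  by rewrite !big_cons DM IH DMl /= -natr1; ring.
by rewrite eig [index_enum _]unlock -enumT size_enum_ord.
Qed.

Section Elimination.
Variables (A : idomainType) (n : nat).
Implicit Types (f g : {mpoly A[n.+1]}) (r : {mpoly A[n]}).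

(** The resultant of [f] and [g] in the last variable is a determinant in their
    coefficients, so that it inherits every derivation of which these
    coefficients are eigenvectors with a common eigenvalue. *)
Lemma eliminate f g : prime_elt f -> ~ divides f g ->
  exists r u v, [/\ r != 0, mwiden r = u * f + v * g &
    forall (D : {additive A -> A}) l,
      derivation D ->
      map_mpoly D f = l *: f -> map_mpoly D g = l *: g ->
      exists l', map_mpoly D r = l' *: r].
Proof.
move=> pf nfg; have [f0 Uf _] := pf.
have g0 : g != 0 by apply: contra_not_neq nfg => ->; exists 0; rewrite mul0r.
have const h : h != 0 -> (size (muni h) <= 1)%N ->
    exists r, [/\ r != 0, mwiden r = h & forall (D : {additive A -> A}) l,
      derivation D ->
      map_mpoly D h = l *: h -> map_mpoly D r = l *: r].
  move=> h0 /size1_polyC e; have eh : h = mwiden (muni h)`_0.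
    by rewrite -of_uniC -e muniK.
  move: (muni h)`_0 eh => r eh; exists r; split=> // [|D l DM e'].
    by apply: contraNneq h0 => r0; rewrite eh r0 mwiden0.
  by apply: (@inj_mwiden n A); rewrite -map_derivation_mwiden // -eh e' mwidenZ eh.
(* If one of the two polynomials is free of the last variable, it can itself be
   taken for r. *)
have [f1|/(const _ f0)[r [r0 er hr]]] := ltnP 1 (size (muni f)); last first.
  exists r, 1, 0; split=> // [|D l DM ef _]; first by rewrite mul1r mul0r addr0.
  by exists l; exact: hr.
have [g1|/(const _ g0)[r [r0 er hr]]] := ltnP 1 (size (muni g)); last first.
  exists r, 0, 1; split=> // [|D l DM _ eg]; first by rewrite mul1r mul0r add0r.
  by exists l; exact: hr.
have [u [v e]] := resultant_ideal f1 g1.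
exists (resultant (muni f) (muni g)), (of_uni u), (of_uni v); split.
- rewrite resultant_eq0; apply: contra_notN nfg => h.
  apply: (proj1 (muni_divides f g)).
  exact: (prime_divides_gcd (proj2 (muni_prime f) pf) f1 h).
- exact: of_uni_combination e.
move=> D l DM ef eg.
have coef_eigen h : map_mpoly D h = l *: h ->
    forall k, map_mpoly D (muni h)`_k = l%:MP * (muni h)`_k.
  move=> eh k; have := congr1 (fun q => (muni q)`_k) eh.
  by rewrite /= muni_map_derivation // coef_map muniZ coefZ.
exists (((size (muni g)).-1 + (size (muni f)).-1)%:R * l).
rewrite -mul_mpolyC rmorphM rmorph_nat.
apply: det_eigen => [x y|i j]; first exact: map_derivationM.
rewrite Sylvester_mxE.
by case: (split i) => k /=; case: (_ <= _)%N;
  rewrite ?mulr1n ?coef_eigen // !mulr0n raddf0 mulr0.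
Qed.

End Elimination.

(** * The Euler field and degrees *)

Section Euler.
Variables (K : idomainType) (n : nat).
Hypothesis char0 : forall k, k.+1%:R != 0 :> K.
Implicit Types F : {mpoly K[n]}.

Definition euler (i : 'I_n) : {mpoly K[n]} := 'X_i.

Lemma mcoeff_euler F m : (vder euler F)@_m = (mdeg m)%:R * F@_m.
Proof.
have ext := raddf_mpoly_ext (f := mcoeff m \o vder euler)
  (g := (mdeg m)%:R \*o mcoeff m); apply: ext => c k /=.
rewrite /vder raddf_sum mcoeffZ mcoeffX /=.
transitivity (\sum_(i < n) (k i)%:R * (c * (k == m)%:R)); last first.
  rewrite -mulr_suml -natr_sum -mdegE.
  by case: eqP => [->//|_]; rewrite !mulr0.
apply: eq_bigr => i _; rewrite mderivZ mderivX -!scalerAr !mcoeffZ.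
rewrite -mpolyXD mcoeffX.
rewrite mulrCA; have [->|ki] := posnP (k i); first by rewrite !mul0r.
by rewrite addmC submK // lep1mP -lt0n.
Qed.

Lemma euler_homog F e : F \is e.-homog -> vder euler F = e%:R *: F.
Proof.
move=> hF; apply/mpolyP => m; rewrite mcoeff_euler mcoeffZ.
have [->//|ne] := eqVneq (mdeg m) e.
by rewrite (dhomog_nemf_coeff hF ne) !mulr0.
Qed.

(** A monomial is multiplied by its degree, which vanishes in characteristic 0
    only for constants. *)
Lemma euler_kernel F : vder euler F = 0 -> F = (F@_0)%:MP.
Proof.
move=> F0; apply/mpolyP => m; rewrite mcoeffC.
have [->|m0] := eqVneq m 0%MM; first by rewrite mulr1.
have := congr1 (mcoeff m) F0; rewrite mcoeff_euler mcoeff0 mulr0 => /eqP.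
rewrite mulf_eq0 => /orP[|/eqP//]; have : mdeg m != 0%N by rewrite mdeg_eq0.
by case: (mdeg m) => // k _; rewrite (negPf (char0 k)).
Qed.

Lemma mderiv_dhomog i F e : F \is e.-homog -> mderiv i F \is e.-1.-homog.
Proof.
move=> hF; apply/dhomogP => m; rewrite mcoeff_msupp mcoeff_mderiv => nz.
have : F@_(m + U_(i)) != 0 by apply: contraNneq nz => ->; rewrite mul0rn.
rewrite -mcoeff_msupp => /(dhomog_mf hF); rewrite -[X in X = _]/(mdeg _).
by rewrite mdegD mdeg1 addn1 => <-.
Qed.

(** The truncated predecessor is harmless: for [e = 0] the form [F] is constant
    and its derivative vanishes. *)
Lemma vder_dhomog d V F e : (forall i, V i \is d.-homog) -> F \is e.-homog ->
  vder V F \is (d + e).-1.-homog.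
Proof.
move=> hV; case: e => [|e] hF.
  by rewrite (dhomog0_const hF) vderC dhomog0.
rewrite addnS; apply: rpred_sum => i _; apply: dhomogM => //.
exact: (mderiv_dhomog i hF).
Qed.

Lemma msize_mderiv i F : mderiv i F != 0 -> (msize (mderiv i F) < msize F)%N.
Proof.
move=> nz; rewrite -(mlead_deg nz).
have := mlead_supp nz; rewrite mcoeff_msupp mcoeff_mderiv => nz'.
have : F@_(mlead (mderiv i F) + U_(i)) != 0.
  by apply: contraNneq nz' => ->; rewrite mul0rn.
by rewrite -mcoeff_msupp => /msize_mdeg_lt; rewrite mdegD mdeg1 addn1.
Qed.

Lemma mderiv_all0 F : (forall i, mderiv i F = 0) -> F = (F@_0)%:MP.
Proof.
by move=> F0; apply: euler_kernel; rewrite /vder big1 // => i _; rewrite F0 mulr0.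
Qed.

End Euler.

Lemma msize_map_le (A A' : nzRingType) n (D : {additive A -> A'})
  (p : {mpoly A[n]}) : (msize (map_mpoly D p) <= msize p)%N.
Proof.
have [->|nz] := eqVneq (map_mpoly D p) 0; first by rewrite msize0.
rewrite -(mlead_deg nz); apply: msize_mdeg_lt.
have := mlead_supp nz; rewrite !mcoeff_msupp mcoeff_map_mpoly.
by apply: contraNneq => ->; rewrite raddf0.
Qed.

(** * The invariant curve through a generic point *)

Lemma cramer2 (R : idomainType) (a b c e x y : R) :
  a * x + b * y = 0 -> c * x + e * y = 0 -> a * e - b * c != 0 ->
  x = 0 /\ y = 0.
Proof.
move=> h1 h2 nz; split; apply: (mulfI nz); rewrite mulr0.
  transitivity (e * (a * x + b * y) - b * (c * x + e * y)); first ring.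
  by rewrite h1 h2 !mulr0 subr0.
transitivity (a * (c * x + e * y) - c * (a * x + b * y)); first ring.
by rewrite h1 h2 !mulr0 subr0.
Qed.

Lemma mderiv_mwiden (R : nzRingType) n (r : {mpoly R[n]}) :
  mderiv ord_max (mwiden r) = 0.
Proof.
apply: (raddf_mpoly_ext (f := mderiv ord_max \o @mwiden n R) (g := \0)) => c m /=.
by rewrite mwidenZ mwidenX mderivZ mderivX mnmwiden_ordmax scale0r scaler0.
Qed.

Section GenericPoint.
Variables (A : idomainType) (v : 'I_3 -> A).
Hypothesis U : ufd A.
Hypothesis char0 : forall k, k.+1%:R != 0 :> A.
Local Notation B := {mpoly A[3]}.
Implicit Types (f g r G : B).

(** The eigenvalue lies in [A] because a derivation of the coefficients does not
    raise the degree. *)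
Lemma prime_eigen (D : {additive A -> A}) f G (a b : A) :
  derivation D ->
  prime_elt f -> f.@[v] = 0 -> G != 0 -> divides f G -> a != 0 ->
  a *: map_mpoly D G = b *: G -> exists l : A, map_mpoly D f = l *: f.
Proof.
move=> DM pf f0 G0 fG a0; rewrite -!mul_mpolyC => e.
(* A constant that is divisible by f vanishes at v. *)
have nconst (c : A) : c != 0 -> ~ divides f c%:MP.
  move=> c0 [h /(congr1 (meval v))]; rewrite mevalC mevalM f0 mulr0.
  by move/eqP; rewrite (negPf c0).
have nat_const k : ~ divides f k.+1%:R.
  by rewrite -(rmorph_nat (@mpolyC 3 A)); exact: nconst.
have UB : ufd B by exact: ufd_mpoly.
have [h eh] := derivation_prime_factor (map_derivationM DM (n := 3)) UB pf
  nat_const (nconst _ a0) G0 fG e.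
have {}eh : map_mpoly D f = h * f := eh.
have [h0|h0] := eqVneq h 0; first by exists 0; rewrite eh h0 mul0r scale0r.
have [fn0 _ _] := pf.
have : (msize (h * f) <= msize f)%N by rewrite -eh; exact: msize_map_le.
rewrite msizeM // (mpolySpred _ fn0) addnS /= -[X in (_ <= X)%N]add1n leq_add2r.
by move=> le_h; exists h@_0; rewrite eh -mul_mpolyC -msize1_polyC.
Qed.

Variables D E : {additive A -> A}.
Hypothesis DM : derivation D.
Hypothesis EM : derivation E.

Let i0 : 'I_3 := ord0.
Let i1 : 'I_3 := Ordinal (isT : (1 < 3)%N).

Let sum3 (T : nmodType) (F : 'I_3 -> T) :
  \sum_i F i = F i0 + F i1 + F ord_max.
Proof.
rewrite !big_ord_recr big_ord0 /= add0r.
by congr (F _ + F _ + F _); apply: val_inj.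
Qed.

(** For the application, [D] is the vector field, [E] the Euler field and [v] the
    generic point y: the condition says that the two fields remain independent
    after projection to the first two coordinates. *)
Hypothesis indep : D (v i0) * E (v i1) - D (v i1) * E (v i0) != 0.

(** Applying the chain rule for [D] and for [E] to [r.@[v] = 0] gives two
    independent linear equations for the partial derivatives of [r] at [v].
    They vanish too, and satisfy the same hypotheses as [r], so that a descent
    on the degree reaches a nonzero constant. *)
Lemma no_relation_in_two_variables r (a b : A) :
  r != 0 -> mderiv ord_max r = 0 ->
  map_mpoly D r = a *: r -> map_mpoly E r = b *: r -> r.@[v] <> 0.
Proof.
have [k] := ubnP (msize r); elim: k r => // k IH r le_k r0 r2 eD eE d0.
have rel (W : {additive A -> A}) c :
    derivation W -> map_mpoly W r = c *: r ->
    W (v i0) * (mderiv i0 r).@[v] + W (v i1) * (mderiv i1 r).@[v] = 0.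
  move=> WM eW; have := derivation_chain WM v r.
  rewrite d0 raddf0 eW mevalZ d0 mulr0 add0r sum3 r2 meval0 mulr0 addr0.
  by [].
have [z0 z1] := cramer2 (rel _ _ DM eD) (rel _ _ EM eE) indep.
have descend i : (mderiv i r).@[v] = 0 -> mderiv i r = 0.
  move=> di; have [//|ne] := eqVneq (mderiv i r) 0.
  have lt := msize_mderiv ne; exfalso; apply: (IH (mderiv i r)) => //.
  - by rewrite ltnS in le_k; apply: leq_trans lt le_k.
  - by rewrite mderiv_comm r2 mderiv0.
  - by rewrite map_derivation_mderiv eD mderivZ.
  - by rewrite map_derivation_mderiv eE mderivZ.
have all0 i : mderiv i r = 0.
  case: (unliftP ord_max i) => [j ->|-> //]; apply: descend.
  case: j => -[|[|j]] lt_j //.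
  - by rewrite (_ : lift _ _ = i0) //; apply: val_inj.
  - by rewrite (_ : lift _ _ = i1) //; apply: val_inj.
have rC := mderiv_all0 char0 all0.
by move: r0; rewrite rC mpolyC_eq0; rewrite rC mevalC in d0; rewrite d0 eqxx.
Qed.

(** The vectors [w] are those of [D], rewritten in the variables of [B]. *)
Variable w : 'I_3 -> B.
Hypotheses (wD : forall i, map_mpoly D (w i) = 0)
  (wE : forall i, map_mpoly E (w i) = 0) (wv : forall i, (w i).@[v] = D (v i)).

Let wder f := \sum_i w i * mderiv i f.

Let wder_eigen (W : {additive A -> A}) f (l : A) :
  derivation W ->
  (forall i, map_mpoly W (w i) = 0) ->
  map_mpoly W f = l *: f -> map_mpoly W (wder f) = l *: wder f.
Proof.
move=> WM w0 ef; rewrite /wder raddf_sum scaler_sumr; apply: eq_bigr => i _.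
rewrite -[LHS]/(map_mpoly W _) map_derivationM // w0 mul0r add0r.
by rewrite map_derivation_mderiv ef mderivZ scalerAr.
Qed.

(** The prime factor [f] of [G] through the point [v] is an eigenvector of [D] and
    [E], hence so is [wder f], with the same eigenvalues; by the chain rule it
    vanishes at [v].  If [f] did not divide it, eliminating the last variable
    between the two would contradict [no_relation_in_two_variables].  Comparing
    the eigenvalues for [E] on both sides of [wder f = L * f] shows that [E]
    kills the coefficients of [L]. *)
Lemma generic_curve G (aD bD aE bE : A) :
  G != 0 -> G.@[v] = 0 -> aD != 0 -> aD *: map_mpoly D G = bD *: G ->
  aE != 0 -> aE *: map_mpoly E G = bE *: G ->
  exists f L, [/\ f != 0, divides f G, f.@[v] = 0, wder f = L * f &
    map_mpoly E L = 0].
Proof.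
move=> G0 Gv aD0 eD aE0 eE; have UB : ufd B by exact: ufd_mpoly.
have [f [pf fG fv]] := ufd_prime_in_kernel (f := meval v) UB G0 Gv.
have [f0 _ _] := pf.
have [lD fD] := prime_eigen DM pf fv G0 fG aD0 eD.
have [lE fE] := prime_eigen EM pf fv G0 fG aE0 eE.
have gD := wder_eigen DM wD fD; have gE := wder_eigen EM wE fE.
have gv : (wder f).@[v] = 0.
  have := derivation_chain DM v f; rewrite fv raddf0 fD mevalZ fv mulr0 add0r.
  move=> e; rewrite [RHS]e /wder raddf_sum; apply: eq_bigr => i _ /=.
  by rewrite mevalM wv.
have [[L eL]|ndiv] := pselect (divides f (wder f)).
  exists f, L; split=> //; apply: (mulIf f0); rewrite mul0r.
  have := gE; rewrite eL map_derivationM // fE => e.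
  apply: (addIr (L * (lE *: f))); rewrite e add0r.
  by rewrite scalerAr.
have [r [x [y [r0 er]]]] := eliminate pf ndiv.
move=> /[dup] /(_ D lD DM fD gD)[l'D rD] /(_ E lE EM fE gE)[l'E rE].
exfalso; apply: (@no_relation_in_two_variables (mwiden r) l'D l'E).
- by rewrite -(inj_eq (@inj_mwiden _ _)) mwiden0 in r0 *.
- exact: mderiv_mwiden.
- by rewrite map_derivation_mwiden // rD mwidenZ.
- by rewrite map_derivation_mwiden // rE mwidenZ.
by rewrite er mevalD !mevalM fv gv !mulr0 addr0.
Qed.

End GenericPoint.

(** * Linear relations from a vanishing Wronskian *)

Section DerivationWronskian.
Variables (A : idomainType) (m : nat) (D E : {additive A -> A}) (u : 'I_m -> A).
Hypothesis DM : derivation D.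
Hypothesis EM : derivation E.

Definition derivation_wronskian : 'M[A]_m := \matrix_(j, i) iter j D (u i).

Let kills (c : 'I_m -> A) k := \sum_i c i * iter k D (u i) = 0.

(** The relations [c] that kill the derivatives of order less than [r] of the
    [u i] form a space that is stable under [D], because the equation of order
    [r] follows from the others, and under [E], because all derivatives of a given
    order are eigenvectors with the same eigenvalue.  For a relation of minimal
    support, normalised by [c i0], the derivative has a smaller support and
    vanishes: the ratios [c i / c i0] are killed by [D] and by [E]. *)
Lemma minimal_relation r (c0 : 'I_m -> A) (eps : nat -> A) :
  (exists i, c0 i != 0) -> (forall k, (k < r)%N -> kills c0 k) ->
  (forall c, (forall k, (k < r)%N -> kills c k) -> kills c r) ->
  (forall k i, E (iter k D (u i)) = eps k * iter k D (u i)) ->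
  exists c i0, [/\ c i0 != 0, forall k, (k < r)%N -> kills c k,
    forall i, c i0 * D (c i) = D (c i0) * c i &
    forall i, c i0 * E (c i) = E (c i0) * c i].
Proof.
move=> nz0 ker0 next eigE.
pose rel c := forall k, (k < r)%N -> kills c k.
pose supp (c : 'I_m -> A) := #|[pred i | c i != 0]|.
have ex : exists N, `[< exists c, [/\ rel c, exists i, c i != 0 & supp c = N] >].
  by exists (supp c0); apply/asboolP; exists c0.
case: (ex_minnP ex) => N /asboolP[c [relc [i0 ci0] sc]] minN.
have vanish (c' : 'I_m -> A) : rel c' -> (forall i, c i = 0 -> c' i = 0) ->
    c' i0 = 0 -> forall i, c' i = 0.
  move=> rel' sub z i; have [//|nz] := eqVneq (c' i) 0.
  have /minN : `[< exists c, [/\ rel c, exists i, c i != 0 & supp c = supp c'] >].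
    by apply/asboolP; exists c'; split=> //; exists i.
  rewrite leqNgt -sc (_ : (supp c' < supp c)%N) //.
  apply: proper_card; apply/properP; split.
    by apply/subsetP => j; rewrite !inE; apply: contra_neq => /sub.
  by exists i0; rewrite !inE ?ci0 // z eqxx.
have wronsk (W : {additive A -> A}) :
    derivation W ->
    rel (fun i => W (c i)) -> forall i, c i0 * W (c i) = W (c i0) * c i.
  move=> WM relW i; apply/eqP; rewrite -subr_eq0; apply/eqP.
  apply: (vanish (fun i => c i0 * W (c i) - W (c i0) * c i)) => [k lt_k|j cj0|].
  - rewrite /kills (eq_bigr (fun j => c i0 * (W (c j) * iter k D (u j)) -
      W (c i0) * (c j * iter k D (u j)))) => [|j _]; last ring.
    by rewrite sumrB -!mulr_sumr (relW k lt_k) (relc k lt_k) !mulr0 subr0.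
  - by rewrite cj0 raddf0 !mulr0 subr0.
  by rewrite mulrC subrr.
exists c, i0; split=> //; apply: wronsk => // k lt_k.
  have := congr1 D (relc k lt_k); rewrite raddf0 raddf_sum /=.
  rewrite (eq_bigr (fun i => D (c i) * iter k D (u i) + c i * iter k.+1 D (u i)));
    last by move=> i _; rewrite DM.
  rewrite big_split /= (_ : \sum_i c i * D (iter k D (u i)) = 0) ?addr0 //.
  have [lt_k1|le_r] := ltnP k.+1 r; first exact: (relc k.+1).
  have er : k.+1 = r by apply/eqP; rewrite eqn_leq lt_k le_r.
  by have := next _ relc; rewrite -er.
have := congr1 E (relc k lt_k); rewrite raddf0 raddf_sum /=.
rewrite (eq_bigr (fun i => E (c i) * iter k D (u i) +
  eps k * (c i * iter k D (u i)))); last by move=> i _; rewrite EM eigE; ring.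
by rewrite big_split /= -mulr_sumr (relc k lt_k) mulr0 addr0.
Qed.

(** The last row involved in a relation between the rows of the matrix supplies
    the order [r]: it depends on the previous ones. *)
Lemma wronskian_relation (eps : nat -> A) :
  (exists i, u i != 0) -> \det derivation_wronskian = 0 ->
  (forall k i, E (iter k D (u i)) = eps k * iter k D (u i)) ->
  exists c i0, [/\ c i0 != 0, \sum_i c i * u i = 0,
    forall i, c i0 * D (c i) = D (c i0) * c i &
    forall i, c i0 * E (c i) = E (c i0) * c i].
Proof.
move=> [iu ui] det0 eigE.
have /det0P[t tn0 tW] : \det derivation_wronskian == 0 by rewrite det0.
have /det0P[c cn0 cW] : \det derivation_wronskian^T == 0 by rewrite det_tr det0.
have [j1 tj1] : exists j, t 0 j != 0 by have /rV0Pn[j tj] := tn0; exists j.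
have [i1 ci1] : exists i, c 0 i != 0 by have /rV0Pn[i ci] := cn0; exists i.
pose r := [arg max_(j > j1 | t 0 j != 0) (j : nat)].
have [tr rmax] : t 0 r != 0 /\ forall j, t 0 j != 0 -> (j <= r)%N.
  by rewrite /r; case: arg_maxnP.
have row i : \sum_j t 0 j * iter j D (u i) = 0.
  have := congr1 (fun M : 'rV_m => M 0 i) tW; rewrite !mxE => e.
  by rewrite -[RHS]e; apply: eq_bigr => j _; rewrite !mxE.
have [|||e [i0 [ei0 rel De Ee]]] :=
  minimal_relation (r := r) (c0 := c 0) _ _ _ eigE.
- by exists i1.
- move=> k lt_k; have lt_km : (k < m)%N by exact: ltn_trans lt_k (ltn_ord r).
  have := congr1 (fun M : 'rV_m => M 0 (Ordinal lt_km)) cW; rewrite !mxE => e.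
  by rewrite /kills -[RHS]e; apply: eq_bigr => j _; rewrite !mxE.
- move=> e rel; apply: (mulfI tr); rewrite mulr0.
  have : \sum_i e i * (\sum_j t 0 j * iter j D (u i)) = 0.
    by rewrite big1 // => i _; rewrite row mulr0.
  rewrite (eq_bigr (fun i => \sum_j t 0 j * (e i * iter j D (u i)))); last first.
    by move=> i _; rewrite mulr_sumr; apply: eq_bigr => j _; rewrite mulrCA.
  rewrite exchange_big (bigD1 r) //= [X in _ + X]big1 => [|j jr].
    by rewrite addr0 -mulr_sumr.
  rewrite -mulr_sumr; have [->|/rmax le_jr] := eqVneq (t 0 j) 0.
    by rewrite mul0r.
  by rewrite (rel j) ?mulr0 // ltn_neqAle val_eqE jr.
exists e, i0; split=> //; apply: (rel 0%N); rewrite lt0n.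
apply: contra_neq ui => r0; have := row iu; rewrite (bigD1 r) //= big1 => [|j jr].
  by rewrite addr0 r0 => /eqP; rewrite mulf_eq0 (negPf tr) => /eqP.
have [->|/rmax] := eqVneq (t 0 j) 0; first by rewrite mul0r.
rewrite r0 leqn0 => /eqP j0; case/eqP: jr; apply: val_inj.
by rewrite /= r0 j0.
Qed.

End DerivationWronskian.

(** * From a vanishing extactic determinant to a first integral *)

Section Pencil.
Variables (K : fieldType) (d n : nat) (V : 'I_3 -> {mpoly K[3]}).
Hypothesis char0 : forall k, k.+1%:R != 0 :> K.
Hypothesis homV : forall i, V i \is d.-homog.
Local Notation A := {mpoly K[3]}.
Local Notation B := {mpoly {mpoly K[3]}[3]}.
Local Notation euler := (@euler K 3).
Implicit Types (F q : A) (p f G : B).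

Definition monomial (i : 'I_('C(n + 2, n))) : 'X_{1..3} :=
  nth 0%MM [seq s2m t | t : n.-tuple 'I_3 <- enum (basis 3 n)] i.

Lemma mdeg_monomial i : mdeg (monomial i) = n.
Proof.
by apply/eqP; rewrite basis_cover mem_nth // size_basis.
Qed.

Lemma monomial_inj : injective monomial.
Proof.
move=> i j /eqP; rewrite nth_uniq ?size_basis ?uniq_basis // => /eqP.
exact: val_inj.
Qed.

Lemma monomial_onto mu : mdeg mu = n -> exists i, mu = monomial i.
Proof.
move/eqP; rewrite basis_cover => mem.
pose b := [seq s2m t | t : n.-tuple 'I_3 <- enum (basis 3 n)].
have lt : (index mu b < 'C(n + 2, n))%N by rewrite -(size_basis 2 n) index_mem.
by exists (Ordinal lt); rewrite /monomial nth_index.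
Qed.

(** The quotient [q1 / q0] is a nonconstant first integral of [V], possibly not in
    lowest terms. *)
Definition pencil e q1 q0 :=
  [/\ q1 \is e.-homog, q0 \is e.-homog, q0 != 0,
    ~ (exists c : K, q1 = c *: q0) & vder V q1 * q0 = q1 * vder V q0].

(** Since [L] is free of y, all coefficients of [f] with respect to y are
    invariant by [V] with the same cofactor, so that quotients of two of them are
    first integrals.  If they were all proportional, [f] would be the product of
    a polynomial in y and a polynomial in x, and neither factor vanishes on the
    diagonal. *)
Lemma generic_curve_pencil e f L : f != 0 -> f \is e.-homog ->
  f.@[fun i => 'X_i] = 0 ->
  \sum_i lift_const (V i) * mderiv i f = L * f ->
  map_mpoly (vder euler) L = 0 -> exists q1 q0, pencil e q1 q0.
Proof.
move=> f0 hf fv eL EL.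
have LC : L = lift_const (slice 0%MM L).
  apply/mpolyP => m; rewrite mcoeff_lift mcoeff_slice; apply: euler_kernel => //.
  by have := congr1 (mcoeff m) EL; rewrite mcoeff_map_mpoly mcoeff0.
have eq mu : vder V (slice mu f) = slice 0%MM L * slice mu f.
  by rewrite -slice_vder eL {1}LC slice_liftM.
have hq mu : slice mu f \is e.-homog.
  apply/dhomogP => m; rewrite mcoeff_msupp mcoeff_slice => nz.
  apply: (dhomog_mf hf); rewrite mcoeff_msupp.
  by apply: contraNneq nz => ->; rewrite mcoeff0.
have m0f := mlead_supp f0; set m0 := mlead f in m0f.
have fm0 : f@_m0 != 0 by rewrite -mcoeff_msupp.
have mu0f := mlead_supp fm0; set mu0 := mlead _ in mu0f.
have nz0 : (slice mu0 f)@_m0 != 0 by rewrite mcoeff_slice -mcoeff_msupp.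
have q0n0 : slice mu0 f != 0 by apply: contraNneq nz0 => ->; rewrite mcoeff0.
pose q0 := slice mu0 f.
have [prop|] := pselect (forall mu m,
  q0@_m0 * (slice mu f)@_m = q0@_m * (slice mu f)@_m0).
  have : (q0@_m0)%:MP *: f = f@_m0 *: lift_const q0.
    apply/mpolyP => m; rewrite !mcoeffZ mcoeff_lift; apply/mpolyP => mu.
    rewrite mcoeffCM [_ * _%:MP]mulrC mcoeffCM -!(mcoeff_slice mu).
    exact: prop.
  move/(congr1 (meval (fun i => 'X_i))); rewrite !mevalZ fv mulr0 lift_const_diag.
  by move/esym/eqP; rewrite mulf_eq0 (negPf fm0) (negPf q0n0).
move=> nprop; have [mu [m ne]] : exists mu m,
    q0@_m0 * (slice mu f)@_m <> q0@_m * (slice mu f)@_m0.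
  apply: contrapT => h; apply: nprop => mu m; apply: contrapT => ne.
  by apply: h; exists mu, m.
exists (slice mu f), q0; split; [exact: hq | exact: hq | exact: q0n0 | | ].
  case=> c e'; apply: ne; rewrite e' !mcoeffZ.
  by move: (q0@_m0) (q0@_m) => x y; ring.
by rewrite !eq -mulrA mulrCA.
Qed.

(** The determinant of this matrix is an equation of the [n]-th extactic curve. *)
Definition extactic : 'M[A]_('C(n + 2, n)) :=
  derivation_wronskian (vder V) (fun i => 'X_[monomial i]).

Fixpoint extactic_degree k := if k is j.+1 then (d + extactic_degree j).-1 else n.

Lemma extactic_dhomog F k : F \is n.-homog ->
  iter k (vder V) F \is (extactic_degree k).-homog.
Proof.
move=> hF; elim: k => //= k IH; exact: (vder_dhomog homV IH).
Qed.

(** A vanishing determinant provides a relation between the monomials whose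
    coefficients have ratios killed by [V] and by the Euler field.  Its
    coefficients are read in y and its monomials in x, which gives the
    polynomial [G] below, to which [generic_curve] applies. *)
Lemma extactic_pencil : (0 < n)%N -> \det extactic = 0 ->
  exists e q1 q0, (e <= n)%N /\ pencil e q1 q0.
Proof.
move=> n0 det0; pose v i : A := 'X_i.
pose i1 := Ordinal (isT : (1 < 3)%N).
(* If V is parallel to the Euler field in the first two coordinates, the quotient
   of these coordinates is a first integral. *)
have [dep|indep] := eqVneq (V ord0 * v i1) (V i1 * v ord0).
  exists 1%N, (v ord0), (v i1); split=> //.
  have hv i : v i \is 1.-homog by rewrite dhomogX /= mdeg1.
  split; [exact: hv | exact: hv | exact: monomial_neq0 | |].
  - case=> c /(congr1 (mcoeff U_(ord0))); rewrite mcoeffZ !mcoeffXU /= => /eqP.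
    by rewrite mulr0 oner_eq0.
  by rewrite /v !vderX dep mulrC.
have hu i k : iter k (vder V) 'X_[monomial i] \is (extactic_degree k).-homog.
  by apply: extactic_dhomog; rewrite dhomogX; apply/eqP/mdeg_monomial.
have eigE k i : vder euler (iter k (vder V) 'X_[monomial i]) =
    ((extactic_degree k)%:R : K)%:MP * iter k (vder V) 'X_[monomial i].
  by rewrite (euler_homog (hu i k)) mul_mpolyC.
have u0 : exists i, 'X_[monomial i] != 0 :> A.
  have lt : (0 < 'C(n + 2, n))%N by rewrite bin_gt0 leq_addr.
  by exists (Ordinal lt); exact: monomial_neq0.
have [c [j [cj rel eD eE]]] :=
  wronskian_relation (vderM V) (vderM euler) u0 det0 eigE.
pose G : B := \sum_i c i *: 'X_[monomial i].
have G0 : G != 0.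
  apply: contra_neq cj => /(congr1 (mcoeff (monomial j))).
  rewrite mcoeff0 raddf_sum (bigD1 j) //= mcoeffZ mcoeffX eqxx mulr1.
  rewrite big1 ?addr0 // => i ij.
  rewrite mcoeffZ mcoeffX (inj_eq monomial_inj) (negPf ij).
  exact: mulr0.
have Gv : G.@[v] = 0.
  rewrite raddf_sum -[RHS]rel; apply: eq_bigr => i _.
  by rewrite /= mevalZ mevalX -mpolyXE_id.
have GD W : (forall i, c j * vder W (c i) = vder W (c j) * c i) ->
    c j *: map_mpoly (vder W) G = vder W (c j) *: G.
  move=> eW; rewrite /G [map_mpoly _ _]raddf_sum !scaler_sumr.
  apply: eq_bigr => i _ /=.
  by rewrite (map_derivationZX (vderM W)) !scalerA eW.
have char0A k : k.+1%:R != 0 :> A.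
  by rewrite -(rmorph_nat (@mpolyC 3 K)) mpolyC_eq0.
have hG : G \is n.-homog.
  apply: rpred_sum => i _; apply: rpredZ; rewrite dhomogX.
  by apply/eqP/mdeg_monomial.
have UA : ufd A by apply/ufd_mpoly/ufd_field.
have wv i : (lift_const (V i)).@[v] = vder V (v i).
  by rewrite lift_const_diag vderX.
have ind : vder V (v ord0) * vder euler (v i1) -
    vder V (v i1) * vder euler (v ord0) != 0.
  by rewrite /v !vderX subr_eq0.
have [f [L [f0 [h eG] fv eL EL]]] := generic_curve UA char0A (vderM V)
  (vderM euler) ind (fun i => map_vder_lift V (V i))
  (fun i => map_vder_lift euler (V i)) wv G0 Gv cj (GD _ eD) cj (GD _ eE).
have hf0 : h * f != 0 by rewrite -eG.
have hfn : h * f \is n.-homog by rewrite -eG.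
have [l [e [_ he len]]] := dhomog_factor hf0 hfn.
have [q1 [q0 P]] := generic_curve_pencil f0 he fv eL EL.
by exists e, q1, q0; split=> //; rewrite -len leq_addl.
Qed.

End Pencil.

(** * Counting invariant curves *)

Lemma quotient_cancel (R : comNzRingType) (D r1 r0 x y z : R) :
  (x * r1 + D * y) * (D * r0) = D * r1 * (x * r0 + D * z) ->
  D ^+ 2 * (y * r0) = D ^+ 2 * (r1 * z).
Proof.
move=> e; have -> : D ^+ 2 * (y * r0) =
  (x * r1 + D * y) * (D * r0) - x * r1 * (D * r0) by ring.
by rewrite e; ring.
Qed.

(** A common factor is homogeneous of positive degree; dividing by it multiplies
    the numerator of the derivative by the inverse of a square. *)
Lemma coprime_pencil (K : fieldType) (V : 'I_3 -> {mpoly K[3]}) e q1 q0 :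
  pencil V e q1 q0 -> exists e' r1 r0, [/\ (e' <= e)%N, pencil V e' r1 r0 &
    forall D s1 s0, r1 = D * s1 -> r0 = D * s0 -> D \is a GRing.unit].
Proof.
have [k] := ubnP e; elim: k e q1 q0 => // k IH e q1 q0 lt_e P.
have [cop|ncop] := pselect (forall D s1 s0 : {mpoly K[3]},
    q1 = D * s1 -> q0 = D * s0 -> D \is a GRing.unit).
  by exists e, q1, q0.
have [D [r1 [r0 [e1 e0 UD]]]] : exists D r1 r0 : {mpoly K[3]},
    [/\ q1 = D * r1, q0 = D * r0 & D \isn't a GRing.unit].
  apply: contrapT => h; apply: ncop => D r1 r0 e1 e0.
  by apply: contrapT => /negP UD; apply: h; exists D, r1, r0.
case: P; rewrite {}e1 {}e0 => h1 h0 q0n0 nprop eX.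
have q1n0 : D * r1 != 0.
  by apply: contra_not_neq nprop => ->; exists 0; rewrite scale0r.
have [a [b [ha hb ab]]] := dhomog_factor q0n0 h0.
have [a' [b' [ha' hb' ab']]] := dhomog_factor q1n0 h1.
have := q0n0; rewrite mulf_eq0 => /norP[D0 r00].
have ea := dhomog_uniq D0 ha ha'.
have a_gt0 : (0 < a)%N.
  rewrite lt0n; apply: contraNneq UD => a0; rewrite a0 in ha.
  have DC := dhomog0_const ha; rewrite DC rmorph_unit // unitfE.
  by apply: contraNneq D0 => c0; rewrite DC c0 mpolyC0.
have eb : b' = b by move: ab'; rewrite -ea -ab => /addnI.
have lt_be : (b < e)%N by rewrite -ab -addn1 addnC leq_add2r.
have [|e' [s1 [s0 [le_e' P' cop']]]] := IH b r1 r0 (leq_trans lt_be lt_e).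
  rewrite eb in hb'; split=> //.
    by case=> c ec; apply: nprop; exists c; rewrite ec scalerAr.
  have D20 : D ^+ 2 != 0 by rewrite expf_neq0.
  apply: (mulfI D20); have := eX; rewrite !vderM.
  move: (vder _ D) (vder _ r1) (vder _ r0) => x y z exyz.
  exact: quotient_cancel exyz.
by exists e', s1, s0; split=> //; exact: leq_trans le_e' (ltnW lt_be).
Qed.

Lemma pencil_first_integral (R : realType) (X : vfield R) e (q1 q0 : Cxyz R) :
  pencil X e q1 q0 -> exists e', (e' <= e)%N /\ has_rational_first_integral X e'.
Proof.
case/coprime_pencil => e' [r1 [r0 [le_e' [h1 h0 r0n0 nprop eX] cop]]].
exists e'; split; first exact: le_e'.
exists r1, r0; split; [by split | by split | |].
  case=> c /eqP; rewrite -[tofrac c%:MP]divr1 -tofrac1.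
  rewrite eqr_div ?tofrac_eq0 ?oner_eq0 // -!tofracM tofrac_eq mulr1 => /eqP ec.
  by apply: nprop; exists c; rewrite -mul_mpolyC.
rewrite vf_fracE // (_ : vf_app X r1 * r0 - r1 * vf_app X r0 = 0).
  by rewrite tofrac0 mul0r.
by apply/eqP; rewrite subr_eq0; apply/eqP; exact: eX.
Qed.

Section Count.
Variables (K : fieldType) (d n : nat) (V : 'I_3 -> {mpoly K[3]}).
Hypothesis char0 : forall k, k.+1%:R != 0 :> K.
Hypothesis homV : forall i, V i \is d.-homog.
Local Notation A := {mpoly K[3]}.
Implicit Types (F p q : A).

Lemma monomial_expansion F : F \is n.-homog ->
  F = \sum_i F@_(monomial i) *: 'X_[@monomial n i].
Proof.
move=> hF; apply/mpolyP => mu; rewrite raddf_sum /=.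
have [/monomial_onto[j ->]|ne] := eqVneq (mdeg mu) n; last first.
  rewrite (dhomog_nemf_coeff hF ne) big1 // => i _.
  rewrite mcoeffZ mcoeffX; case: eqP => [e|]; last by rewrite mulr0.
  by case/eqP: ne; rewrite -e mdeg_monomial.
rewrite (bigD1 j) //= mcoeffZ mcoeffX eqxx mulr1 big1 ?addr0 // => i ij.
by rewrite mcoeffZ mcoeffX (inj_eq (@monomial_inj n)) (negPf ij) mulr0.
Qed.

(** The coefficients of [F] on the monomials form a constant vector that the
    extactic matrix sends to the iterated derivatives of [F], all multiples of
    [F].  Multiplying by the adjugate matrix, a nonzero constant times the
    determinant is a multiple of [F]. *)
Lemma invariant_divides_extactic F : F != 0 -> F \is n.-homog ->
  divides F (vder V F) -> divides F (\det (extactic n V)).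
Proof.
move=> F0 hF [L eL].
have div_iter (j : 'I_('C(n + 2, n))) : exists l, iter j (vder V) F = l * F.
  elim: (j : nat) => [|k [l /= ->]]; first by exists 1; rewrite mul1r.
  by exists (vder V l + l * L); rewrite vderM eL mulrDl mulrA.
have [l el] := fin_all_exists div_iter.
pose c := \col_i (F@_(@monomial n i))%:MP : 'cV[A]_('C(n + 2, n)).
have Wc : extactic n V *m c = F *: \col_j l j.
  have iterE s : iter s (vder V) F =
      \sum_i F@_(monomial i) *: iter s (vder V) 'X_[@monomial n i].
    elim: s => [|s IHs]; first exact: monomial_expansion.
    by rewrite iterS IHs raddf_sum; apply: eq_bigr => i _; rewrite /= linearZ.
  apply/matrixP => j k; rewrite !mxE [F * _]mulrC -el iterE.
  by apply: eq_bigr => i _; rewrite !mxE mulrC mul_mpolyC.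
have [i ci] : exists i, F@_(@monomial n i) != 0.
  have := mlead_supp F0; rewrite mcoeff_msupp => nz.
  have [|i ei] := @monomial_onto n (mlead F); last by exists i; rewrite -ei.
  by apply: (dhomog_mf hF); rewrite mcoeff_msupp.
have : \adj (extactic n V) *m (extactic n V *m c) = \det (extactic n V) *: c.
  by rewrite mulmxA mul_adj_mx mul_scalar_mx.
rewrite Wc -scalemxAr => /matrixP/(_ i ord0); rewrite !mxE.
move: (\sum_j _) (\det _) => s D e; exists ((F@_(monomial i))^-1 *: s).
by rewrite -scalerAl mulrC e mulrC mul_mpolyC scalerA mulVf // scale1r.
Qed.

(** Pairwise nonassociated primes dividing [D] can be divided out one after the
    other. *)
Lemma prime_divisors_degree k (p : 'I_k -> A) D N :
  (forall i, prime_elt (p i)) -> (forall i, p i \is n.-homog) ->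
  (forall i j, divides (p i) (p j) -> i = j) ->
  (forall i, divides (p i) D) -> D != 0 -> D \is N.-homog -> (k * n <= N)%N.
Proof.
move=> pp hp inj divD D0 hD.
suff bound (s : seq 'I_k) : uniq s -> forall D N, D != 0 -> D \is N.-homog ->
    (forall i, i \in s -> divides (p i) D) -> (size s * n <= N)%N.
  by rewrite -[k](size_enum_ord k); apply: bound D0 hD _; rewrite ?enum_uniq.
elim: s => //= i s IH /andP[i_s us] {}D {}N {}D0 {}hD {}divD.
have [c ec] := divD i (mem_head _ _); rewrite ec in D0 hD divD.
have [a [b [ha hb ab]]] := dhomog_factor D0 hD.
have := D0; rewrite mulf_eq0 => /norP[c0 pi0].
have eb := dhomog_uniq pi0 hb (hp i); rewrite mulSn -ab eb addnC leq_add2r.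
apply: (IH us c) => // j js; have [_ _ prj] := pp j.
have := divD j; rewrite inE js orbT => /(_ isT) /prj[//|/inj ji].
by rewrite -ji js in i_s.
Qed.

Lemma extactic_det_dhomog :
  \det (extactic n V) \is (\sum_(j < 'C(n + 2, n)) extactic_degree d n j).-homog.
Proof.
rewrite /determinant; apply: rpred_sum => s _; rewrite rpredMsign.
elim/big_rec2: _ => [|i e q _ hq]; first exact: dhomog1.
apply: dhomogM hq; rewrite mxE; apply: (extactic_dhomog homV).
by rewrite dhomogX; apply/eqP/mdeg_monomial.
Qed.

End Count.

Lemma extactic_degreeS d n k : extactic_degree d.+1 n k = (n + k * d)%N.
Proof.
elim: k => [|k /= ->]; first by rewrite mul0n addn0.
by rewrite mulSn addnCA.
Qed.

Lemma extactic_degree0 n k : extactic_degree 0 n k = (n - k)%N.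
Proof. by elim: k => [|k /= ->]; rewrite ?subn0 // add0n subnS. Qed.

(** Differentiating [n.+1] times along a constant field kills the forms of
    degree [n], and there are more than [n.+1] monomials of that degree. *)
Lemma extactic_constant_field (K : fieldType) n (V : 'I_3 -> {mpoly K[3]}) :
  (forall i, V i \is 0.-homog) -> (0 < n)%N ->
  \det (extactic n V) = 0.
Proof.
move=> homV n_gt0.
have lt : (n.+1 < 'C(n + 2, n))%N.
  by rewrite -[X in 'C(_, X)](addnK 2 n) bin_sub ?leq_addl // addn2 bin2; nia.
rewrite (expand_det_row _ (Ordinal lt)) big1 // => i _.
have hX : 'X_[monomial i] \is [in K[3], n.-homog].
  by rewrite dhomogX; apply/eqP/mdeg_monomial.
have := extactic_dhomog homV n hX; rewrite extactic_degree0 subnn => hn.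
have e0 : iter n.+1 (vder V) 'X_[monomial i] = 0.
  by rewrite iterS (dhomog0_const hn) vderC.
by rewrite mxE [X in X * _]e0 mul0r.
Qed.

Lemma sum_extactic_degree d n : (0 < n)%N ->
  (8 * \sum_(j < 'C(n + 2, n)) extactic_degree d.+1 n j =
   n * ((n + 1) * (n + 2) * (4 + d * (n + 3))))%N.
Proof.
move=> n_gt0; under eq_bigr do rewrite extactic_degreeS.
rewrite big_split /= sum_nat_const card_ord -big_distrl /=.
have -> : 'C(n + 2, n) = 'C(n + 2, 2) by rewrite -(bin_sub (leq_addl n 2)) addnK.
rewrite -[X in (_ + X * _)%N](big_mkord xpredT id) bin2_sum.
have twice k : (2 * 'C(k, 2) = k * k.-1)%N by rewrite -mul_bin_diag bin1.
have := twice (n + 2)%N; have := twice 'C(n + 2, 2).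
move: 'C(n + 2, 2) => y; move: 'C(y, 2) => x; rewrite addn2 /= => exy ey.
case: y exy ey => [|y] /= exy ey; first by rewrite muln0 in ey.
have {}exy : (8 * x = 4 * (y.+1 * y))%N by lia.
have ey' : (2 * y = n * (n + 3))%N by lia.
have ex : (8 * x = (n + 1) * (n + 2) * (n * (n + 3)))%N.
  by rewrite exy -ey' [LHS](_ : _ = (2 * y.+1) * (2 * y))%N ?ey; lia.
rewrite mulnDr !mulnA ex [(8 * y.+1)%N](_ : _ = 4 * (2 * y.+1))%N ?ey; lia.
Qed.

(** * The bound *)

Theorem corollary1 (R : realType) (d n : nat) (X : vfield R) :
  homogeneous_vfield d X ->
  (0 < n)%N ->
  ~ (exists e : nat, (e <= n)%N /\ has_rational_first_integral X e) ->
  forall (k : nat) (F : 'I_k -> Cxyz R),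
    (forall i, irreducible_invariant_curve X n (F i)) ->
    (forall i j, same_curve (F i) (F j) -> i = j) ->
    k%:R <= (d%:R * (n%:R ^+ 3 + 6 * n%:R ^+ 2 + 11 * n%:R + 6)
             - n%:R ^+ 3 - 2 * n%:R ^+ 2 + n%:R + 2) / 8 :> rat.
Proof.
move=> [homX _] n_gt0 noFI k F curveF distinct.
have char0 j : j.+1%:R != 0 :> R[i] by rewrite pnatr_eq0.
have det0 : \det (extactic n X) != 0.
  apply/eqP => /(extactic_pencil char0 homX n_gt0)[e [q1 [q0 [le_e P]]]].
  have [e' [le_e' FI]] := pencil_first_integral P.
  by apply: noFI; exists e'; split; [exact: leq_trans le_e' le_e | exact: FI].
have [ufdA _] : ufd (Cxyz R) by apply/ufd_mpoly/ufd_field.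
have primeF i : prime_elt (F i) by have [_ irr _] := curveF i; exact: ufdA.
have homF i : F i \is n.-homog by have [] := curveF i.
have F0 i : F i != 0 by have [] := primeF i.
have divF i : divides (F i) (\det (extactic n X)).
  have [_ _ [L eL]] := curveF i.
  exact: invariant_divides_extactic (F0 i) (homF i) (ex_intro _ L eL).
(* A quotient of two forms of the same degree is a constant. *)
have injF i j : divides (F i) (F j) -> i = j.
  case=> c ec; apply: distinct.
  have cF0 : c * F i != 0 by rewrite -ec.
  have hcF : c * F i \is n.-homog by rewrite -ec.
  have [a [b [ha hb ab]]] := dhomog_factor cF0 hcF.
  have bn := dhomog_uniq (F0 i) hb (homF i).
  have a0 : a = 0%N by move: ab; rewrite bn; lia.
  rewrite a0 in ha; have cC := dhomog0_const ha.
  exists c@_0; last by rewrite ec {1}cC mul_mpolyC.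
  by apply: contra_neq cF0 => c0; rewrite cC c0 mpolyC0 mul0r.
have le_deg := prime_divisors_degree primeF homF injF divF det0
  (extactic_det_dhomog n homX).
(* A constant field is set apart: the degrees of the derivatives would have to
   become negative. *)
move: d homX le_deg => [|d'] homX le_deg.
  by rewrite (extactic_constant_field homX n_gt0) eqxx in det0.
have le_k : (8 * k <= (n + 1) * (n + 2) * (4 + d' * (n + 3)))%N.
  rewrite -(leq_pmul2l n_gt0) -(sum_extactic_degree d' n_gt0).
  by rewrite mulnCA leq_mul2l /= mulnC.
have -> : d'.+1%:R * (n%:R ^+ 3 + 6 * n%:R ^+ 2 + 11 * n%:R + 6) - n%:R ^+ 3 -
    2 * n%:R ^+ 2 + n%:R + 2 =
    ((n + 1) * (n + 2) * (4 + d' * (n + 3)))%:R :> rat.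
  by rewrite -natr1 !(natrM, natrD); ring.
by rewrite ler_pdivlMr ?ltr0n // -natrM ler_nat mulnC.
Qed.
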